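(* Let $e,m,n$ be integers with $1\le m<n\le e-2$. The ring $\mathbb K[\overline{S(e,m,n)}]$ is Cohen--Macaulay if and only if $(m,n)\ne(e-4,e-3)$.
   Context: $\mathbb K$ is an algebraically closed field of characteristic zero. $\overline{S(e,m,n)}\subseteq\mathbb N^2$ is the affine semigroup generated by $(e+i,\,e-1-i)$ for $i\in\{0,\ldots,e-1\}\setminus\{m,n\}$ together with $(0,2e-1)$. $\mathbb K[\overline{S(e,m,n)}]$ is its semigroup ring, i.e. the subalgebra of $\mathbb K[t_1,t_2]$ generated by the monomials $t_1^{e+i}t_2^{e-1-i}$, $i\in\{0,\ldots,e-1\}\setminus\{m,n\}$, and $t_2^{2e-1}$; it is the coordinate ring of the projective monomial curve in $\mathbb P^{e-2}$ defined by the numerical semigroup $S(e,m,n)=\langle\{e,\ldots,2e-1\}\setminus\{e+m,e+n\}\rangle$. *)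

(* Defs.v *)
From HB Require Import structures.
From mathcomp Require Import all_boot all_order all_algebra.
From mathcomp.classical Require Import boolp.
From mathcomp.multinomials Require Import mpoly.

Set Implicit Arguments.
Unset Strict Implicit.
Unset Printing Implicit Defensive.

Import GRing.Theory.

Local Open Scope ring_scope.

(* In ring_quotient, [idealr_closed I] includes [1 \notin I]: the predicates it
   describes are the proper ideals. *)

Section Ideals.

Variable R : comNzRingType.
Implicit Types (I J M : {pred R}) (s : seq R).

Definition maximal_ideal M : Prop :=
  idealr_closed M /\
  forall J, idealr_closed J -> {subset M <= J} -> {subset J <= M}.

Definition in_ideal_gen s (x : R) : Prop :=
  exists c : nat -> R, x = \sum_(i < size s) c i * s`_i.

(* The unit ideal, which [idealr_closed] leaves out, is generated by 1. *)
Definition noetherian : Prop :=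
  forall I, idealr_closed I -> exists s, forall x, x \in I <-> in_ideal_gen s x.

Definition regular_seq s : Prop :=
  (forall i x, (i < size s)%N ->
     in_ideal_gen (take i s) (s`_i * x) -> in_ideal_gen (take i s) x) /\
  ~ in_ideal_gen s 1.

(* The common length of the maximal regular sequences in [I], when [R] is
   noetherian. *)
Definition has_depth I (d : nat) : Prop :=
  (exists s, [/\ size s = d, {subset s <= I} & regular_seq s]) /\
  (forall s, {subset s <= I} -> regular_seq s -> (size s <= d)%N).

Definition prime_chain (d : nat) (c : nat -> prime_idealr R) : Prop :=
  forall i, (i < d)%N ->
    {subset c i <= c i.+1} /\ exists2 x, x \in c i.+1 & x \notin c i.

Definition has_krull_dim (d : nat) : Prop :=
  (exists c, prime_chain d c) /\
  (forall k c, prime_chain k c -> (k <= d)%N).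

Definition cohen_macaulay_local : Prop :=
  exists M d, [/\ maximal_ideal M,
    (forall N, maximal_ideal N -> N =i M), has_krull_dim d & has_depth M d].

End Ideals.

(* The localization of a domain at a prime ideal, as the subring of its field of
   fractions consisting of the a / s with s outside the prime. *)

Section Localization.

Variables (R : idomainType) (P : prime_idealr R).

Definition localization_pred : {pred {fraction R}} :=
  fun x => `[< exists a s : R, s \notin P /\ x = tofrac a / tofrac s >].

Let P0 s : s \notin P -> tofrac s != 0.
Proof. by apply: contraNneq => /eqP; rewrite tofrac_eq0 => /eqP->; apply: idealr0. Qed.

Let PM s t : s \notin P -> t \notin P -> s * t \notin P.
Proof. by rewrite prime_idealrM negb_or => -> ->. Qed.

Lemma localization_subring_closed : subring_closed localization_pred.
Proof.
split.
- apply/asboolP; exists 1, 1; split; first by rewrite idealr1.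
  by rewrite rmorph1 divr1.
- move=> x y /asboolP[a [s [sP ->]]] /asboolP[b [t [tP ->]]].
  apply/asboolP; exists (a * t - b * s), (s * t); split; first exact: PM.
  rewrite -mulNr addf_div ?P0// mulNr.
  by rewrite [in RHS]rmorphB !rmorphM.
- move=> x y /asboolP[a [s [sP ->]]] /asboolP[b [t [tP ->]]].
  apply/asboolP; exists (a * b), (s * t); split; first exact: PM.
  by rewrite mulf_div !rmorphM.
Qed.

HB.instance Definition _ := GRing.isSubringClosed.Build {fraction R}
  localization_pred localization_subring_closed.

Record localization := Localization {
  localization_val :> {fraction R};
  _ : localization_val \in localization_pred }.

HB.instance Definition _ := [isSub for localization_val].
HB.instance Definition _ := [Choice of localization by <:].
HB.instance Definition _ :=
  [SubChoice_isSubComNzRing of localization by <:].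

End Localization.

Definition cohen_macaulay (R : idomainType) : Prop :=
  noetherian R /\
  forall M : prime_idealr R, maximal_ideal M ->
    cohen_macaulay_local (localization M).

(* The semigroup ring K[<G>] of the affine semigroup <G> of N^n generated by G,
   as the K-subalgebra of K[t_1, ..., t_n] generated by the monomials t^g, g in
   G. *)

Section SemigroupRing.

Variables (K : fieldType) (n : nat) (G : seq 'X_{1..n}).

Definition semigroup_ring_pred : {pred {mpoly K[n]}} :=
  fun p => `[< forall A : {pred {mpoly K[n]}},
    subalg_closed A -> (forall g, g \in G -> 'X_[g] \in A) -> p \in A >].

Lemma semigroup_ring_divalg_closed : divalg_closed semigroup_ring_pred.
Proof.
have lin : GRing.linear_closed semigroup_ring_pred.
  move=> a u v /asboolP uA /asboolP vA; apply/asboolP => A Acl GA.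
  by have [_ AZ _] := Acl; apply: AZ; [apply: uA | apply: vA].
have S1 : 1 \in semigroup_ring_pred by apply/asboolP => A [].
split=> // u v uS vS.
have vVS : v^-1 \in semigroup_ring_pred.
  have [|/invr_out->//] := boolP (v \is a GRing.unit).
  move=> vU; have /andP[/eqP vE cU] : v \in @mpoly_unit n K by exact: vU.
  have -> : v^-1 = (v@_0)^-1 *: 1 + (-1 *: 1 + 1).
    by rewrite scaleN1r addNr addr0 {1}vE -mul_mpolyC mulr1 rmorphV.
  by do 2!apply: (lin) => //.
apply/asboolP => A Acl GA; have [_ _ AM] := Acl.
by apply: AM; [apply: (asboolP _ uS) | apply: (asboolP _ vVS)].
Qed.

HB.instance Definition _ := GRing.isDivalgClosed.Build K {mpoly K[n]}
  semigroup_ring_pred semigroup_ring_divalg_closed.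

Record semigroup_ring := SemigroupRing {
  semigroup_ring_val :> {mpoly K[n]};
  _ : semigroup_ring_val \in semigroup_ring_pred }.

HB.instance Definition _ := [isSub for semigroup_ring_val].
HB.instance Definition _ := [Choice of semigroup_ring by <:].
HB.instance Definition _ :=
  [SubChoice_isSubIntegralDomain of semigroup_ring by <:].
HB.instance Definition _ :=
  [SubZmodule_isSubLmodule of semigroup_ring by <:].
HB.instance Definition _ :=
  [SubNzRing_SubLmodule_isSubLalgebra of semigroup_ring by <:].
HB.instance Definition _ :=
  [SubLalgebra_isSubAlgebra of semigroup_ring by <:].

End SemigroupRing.

(* The exponent (a, b) of the monomial t_1 ^ a * t_2 ^ b. *)
Definition bidegree (a b : nat) : 'X_{1..2} := [multinom [tuple a; b]].

Definition Sbar_gens (e m n : nat) : seq 'X_{1..2} :=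
  rcons [seq bidegree (e + i) (e - 1 - i) | i <- iota 0 e & i \notin [:: m; n]]
    (bidegree 0 (2 * e - 1)).

(* Main.v *)
From HB Require Import structures.
Require Import Defs.
From mathcomp Require Import all_boot all_order all_algebra.
From mathcomp.classical Require Import boolp.
From mathcomp.classical Require classical_sets.
From mathcomp.multinomials Require Import mpoly.
From mathcomp Require Import zify ring.

(** Write D = 2 e - 1, let S be the semigroup, R its ring, and x = t1^D, y = t2^D,
    which both belong to R. The elements of R are the polynomials with exponents in S
    (semigroup_ringP), and R is a finitely generated module over K[x, y]. The theorem
    rests on the classical criterion that R is Cohen-Macaulay exactly when
    c + (D, 0) and c + (0, D) in S imply c in S.

    If the implication holds, let M be a maximal ideal. By the Nullstellensatz
    (nullstellensatz, maximal_ideal_point) it contains x - a and y - b for some a, b in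
    K, and these binomials form a regular sequence (binomials_regular): a syzygy
    comes from some h in K[t1, t2], and the implication, applied to
    an exponent of h of maximal degree outside S, shows that h is in R. So the local
    ring at M has depth at least two, and it has dimension at least two because a prime
    can be found that contains x - a and avoids the powers of y - b. Both
    numbers are at most two for a common reason: a regular sequence of length three or a
    chain of four primes would give three elements of R that are algebraically independent
    over K (chain_alg_indep), while any three polynomials in two variables are
    dependent (alg_dep). The ring is noetherian by Dickson's lemma
    applied to leading monomials (semigroup_ring_noetherian).

    If some c outside S becomes an element of S whichever generator is added to it, then t^c
    is a fraction outside the local ring at the origin which the maximal ideal multiplies
    into it. This forces depth at most one
    (loc_not_cohen_macaulay), while the dimension is two.

    The combinatorial part decides between the two situations. Points of S are
    determined by their degree k D and their second coordinate, which has to be a sum of k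
    of the numbers D and i in [0, e - 1] other than p = e - 1 - n and q = e - 1 - m. In this
    language the implication says that a small number that is a sum of k + 1
    elements of [0, e - 1] without p and q is already a sum of k of them. This is so
    (kept_sum_shorten) unless p = 2 and q = 3, when 3 = 1 + 1 + 1 is not a sum of two
    of them; this exception is the case (m, n) = (e - 4, e - 3), and it produces
    the point c (in_Sbar_socle). *)

Set Implicit Arguments.
Unset Strict Implicit.
Unset Printing Implicit Defensive.

Import Order.TTheory GRing.Theory.

(** * Sums of elements of an interval with two gaps *)

Definition gapped e p q i := [&& i < e, i != p & i != q].

Definition is_sum (A : pred nat) k s := exists l, [/\ size l = k, all A l & sumn l = s].

Lemma gappedP e p q i : reflect (i < e /\ i <> p /\ i <> q) (gapped e p q i).
Proof.
rewrite /gapped; apply: (iffP idP) => [/and3P[-> /eqP ? /eqP ?] //|[-> [/eqP ? /eqP ?]]].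
by apply/and3P.
Qed.

Section Triples.
Variables e p q : nat.
Hypotheses (p_gt0 : 0 < p) (lt_pq : p < q) (q_le : q <= e - 2).
Local Notation kept i := (i < e /\ i <> p /\ i <> q).

(** Let s be the sum. Writing s = 0 + s settles all s except the gaps p and q; a gap
    p > 1 is 1 + (p - 1), and q > 3 is i + (q - i) with i one of 1, 2, 3, where p and
    q - p rule out at most two of the three. The gaps that are left are not sums of three
    kept elements, except for 3 = 1 + 1 + 1 when p = 2 and q = 3. *)
Lemma kept_low_triple u v w : kept u -> kept v -> kept w -> u + v + w < e ->
  ~ (p = 2 /\ q = 3 /\ u + v + w = 3) ->
  exists i j, [/\ kept i, kept j & i + j = u + v + w].
Proof.
move=> Ku Kv Kw.
have: ~ (p = 1 /\ u + v + w = 1) by lia.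
have: ~ (p = 1 /\ q = 2 /\ u + v + w = 2) by lia.
have: ~ (p = 1 /\ q = 3 /\ u + v + w = 3) by lia.
move: (u + v + w) => s {u v w Ku Kv Kw} n13 n12 n1 lts nbad.
have [|nsp] := eqVneq s p.
  by exists 1, (s - 1); split; lia.
have [sq|/eqP nsq] := eqVneq s q; last by exists 0, s; split; lia.
have q4 : 3 < q by lia.
have [p1|np1] := boolP ((p != 1) && (q - p != 1)).
  by exists 1, (s - 1); split; lia.
have [p2|np2] := boolP ((p != 2) && (q - p != 2)).
  by exists 2, (s - 2); split; lia.
by exists 3, (s - 3); split; lia.
Qed.

(** If t := s - (e - 1) is kept, then i = 0 and j = t do. A gap t is split as in the
    previous lemma, unless t = 1 or t = q <= 3; then s, which is close to e, is itself
    a sum of two kept elements of [2, e - 2]. *)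
Lemma kept_mid s : 6 <= e -> e <= s -> s <= 2 * (e - 1) ->
  exists i j, [/\ kept i, kept j & i + j = s \/ i + j + (e - 1) = s].
Proof.
move=> e6 les lts.
have [t Et] : {t | s = e - 1 + t} by exists (s - (e - 1)); lia.
have [tp|/eqP ntp] := eqVneq t p.
  have [t1|/eqP nt1] := eqVneq t 1; last by exists 1, (t - 1); split; lia.
  have [/andP[/eqP q2 /eqP q2']|E] := boolP ((q != 2) && (q != e - 2)).
    by exists 2, (e - 2); split; lia.
  have [/andP[/eqP q3 /eqP q3']|E'] := boolP ((q != 3) && (q != e - 3)).
    by exists 3, (e - 3); split; lia.
  by exists 4, (e - 4); split; lia.
have [tq|/eqP ntq] := eqVneq t q; last by exists 0, t; split; lia.
have [q3|q4] := leqP q 3.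
  have [q2|/eqP q3'] := eqVneq q 2.
    by exists 3, (e - 2); split; lia.
  by exists 4, (e - 2); split; lia.
have [/andP[/eqP p1 /eqP p1']|np1] := boolP ((p != 1) && (q - p != 1)).
  by exists 1, (t - 1); split; lia.
have [/andP[/eqP p2 /eqP p2']|np2] := boolP ((p != 2) && (q - p != 2)).
  by exists 2, (t - 2); split; lia.
by exists 3, (t - 3); split; lia.
Qed.

(** For e <= 5 there are only four gap pairs, and some s have no such splitting:
    there the hypothesis that s is a sum of three kept elements is essential, and
    the claim is checked by enumeration. *)
Lemma kept_mid_small u v w : e <= 5 -> kept u -> kept v -> kept w ->
  e <= u + v + w -> u + v + w <= 2 * (e - 1) ->
  exists i j, [/\ kept i, kept j &
    i + j = u + v + w \/ i + j + (e - 1) = u + v + w].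
Proof.
move=> e5 /gappedP Ku /gappedP Kv /gappedP Kw les lts.
pose test e p q := let K := [seq i <- iota 0 e | gapped e p q i] in
  all (fun u => all (fun v => all (fun w =>
    (e <= u + v + w <= 2 * (e - 1)) ==>
    has (fun i => has (fun j => (i + j == u + v + w) ||
      (i + j + (e - 1) == u + v + w)) K) K) K) K) K.
have epq : test e p q.
  have : (e, p, q) \in [:: (4, 1, 2); (5, 1, 2); (5, 1, 3); (5, 2, 3)].
    by rewrite !inE !xpair_eqE; lia.
  by rewrite !inE => /or4P[] /eqP[-> -> ->].
have memK i : gapped e p q i -> i \in [seq i <- iota 0 e | gapped e p q i].
  by move=> Ki; rewrite mem_filter Ki mem_iota; case/gappedP: Ki.
have := allP (allP (allP epq _ (memK _ Ku)) _ (memK _ Kv)) _ (memK _ Kw).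
rewrite les lts /= => /hasP[i + /hasP[j + ij]].
rewrite !mem_filter => /andP[/gappedP Ki _] /andP[/gappedP Kj _].
by exists i, j; split=> //; case/orP: ij => /eqP; [left | right].
Qed.

Lemma kept_mid_triple u v w : kept u -> kept v -> kept w ->
  e <= u + v + w -> u + v + w <= 2 * (e - 1) ->
  exists i j, [/\ kept i, kept j &
    i + j = u + v + w \/ i + j + (e - 1) = u + v + w].
Proof.
move=> Ku Kv Kw les lts; have [e5|e6] := leqP e 5; first exact: kept_mid_small.
exact: kept_mid.
Qed.

End Triples.

Section Sums.
Variables e p q : nat.
Hypotheses (p_gt0 : 0 < p) (lt_pq : p < q) (q_le : q <= e - 2).
Hypothesis not23 : ~ (p = 2 /\ q = 3).
Local Notation kept i := (i < e /\ i <> p /\ i <> q).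

(** Sums exceeding 2 (e - 1) are reduced to those below e by the reflection
    x |-> e - 1 - x, which exchanges the gap pairs (p, q) and (e - 1 - q, e - 1 - p);
    the second alternative is the mirror image of 3 = 1 + 1 + 1. *)
Lemma kept_triple u v w : kept u -> kept v -> kept w ->
  (exists i j, [/\ kept i, kept j &
     i + j = u + v + w \/ i + j + (e - 1) = u + v + w])
  \/ [/\ u = e - 2, v = e - 2, w = e - 2, p = e - 4 & q = e - 3].
Proof.
move=> Ku Kv Kw.
have [low|] := ltnP (u + v + w) e.
  left; have [|i [j [Ki Kj E]]] := kept_low_triple p_gt0 lt_pq q_le Ku Kv Kw low.
    by move=> [p2 [q3 _]]; apply: not23.
  by exists i, j; split => //; left.
move=> les; have [mid|high] := leqP (u + v + w) (2 * (e - 1)).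
  left; exact: (kept_mid_triple p_gt0 lt_pq q_le Ku Kv Kw les mid).
have [/and3P[/eqP eq /eqP ep /eqP euvw]|nb] :=
  boolP [&& e - 1 - q == 2, e - 1 - p == 3 & u + v + w == 3 * (e - 2)].
  have big x a b : kept x -> a < e -> b < e -> x + a + b = 3 * (e - 2) -> e - 2 <= x.
    by clear -q_le lt_pq p_gt0 eq ep; lia.
  have e_gt1 : 1 < e by lia.
  have ue := big u v w Ku (proj1 Kv) (proj1 Kw) euvw.
  have ve : e - 2 <= v by apply: (big v u w) => //; [case: Ku | case: Kw | lia].
  have we : e - 2 <= w by apply: (big w u v) => //; [case: Ku | case: Kv | lia].
  right; clear big Ku Kv Kw high les not23 p_gt0 lt_pq q_le.
  by split; lia.
left.
have K' x : kept x -> e - 1 - x < e /\ e - 1 - x <> e - 1 - q /\ e - 1 - x <> e - 1 - p.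
  by clear -q_le lt_pq p_gt0; lia.
have [|||||i [j [Ki Kj E]]] := @kept_low_triple e (e - 1 - q) (e - 1 - p) _ _ _
    _ _ _ (K' _ Ku) (K' _ Kv) (K' _ Kw); clear K'.
- by clear -q_le lt_pq; lia.
- by clear -q_le lt_pq; lia.
- by clear -q_le lt_pq p_gt0; lia.
- by case: Ku Kv Kw => [ue _] [ve _] [we _]; clear -q_le lt_pq p_gt0 ue ve we high; lia.
- case: Ku Kv Kw => [ue _] [ve _] [we _] [eq [ep euvw]]; case/negP: nb.
  by clear -q_le lt_pq p_gt0 ue ve we high eq ep euvw; lia.
exists (e - 1 - i), (e - 1 - j).
case: Ku Kv Kw => [ue _] [ve _] [we _].
split; [clear -q_le lt_pq p_gt0 Ki; lia | clear -q_le lt_pq p_gt0 Kj; lia |].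
case: Ki Kj => [ie _] [je _].
by right; clear -q_le lt_pq p_gt0 ue ve we high ie je E; lia.
Qed.

(** A fourth summand removes the exceptional alternative of the previous lemma, because
    4 * (e - 2) = 3 * (e - 1) + (e - 5). *)
Lemma kept_quadruple u v w z : kept u -> kept v -> kept w -> kept z ->
  exists i j k, [/\ kept i, kept j, kept k &
    i + j + k = u + v + w + z \/ i + j + k + (e - 1) = u + v + w + z].
Proof.
move=> Ku Kv Kw Kz.
have [[i [j [Ki Kj E]]]|[u1 v1 w1 ep eq]] := kept_triple Ku Kv Kw.
  by exists i, j, z; split => //; clear -E; lia.
have [[i [j [Ki Kj E]]]|[_ _ z1 _ _]] := kept_triple Kv Kw Kz.
  by exists i, j, u; split => //; clear -E; lia.
exists (e - 1), (e - 1), (e - 5); clear Ku Kv Kw Kz not23.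
by split; [lia | lia | lia | right; lia].
Qed.

(** For k = 2 the bound means s < e - 1, which kept_low_triple covers. Among at least
    four summands, four can be replaced by three either with the same
    total, or with the total diminished by e - 1; in the latter case induction shortens
    the sum further and the summand e - 1 is put back. *)
Lemma kept_sum_shorten k s : s + e <= k * (e - 1) ->
  is_sum (gapped e p q) k.+1 s -> is_sum (gapped e p q) k s.
Proof.
have le1 : e - 1 < e by clear -q_le lt_pq; lia.
elim: k s => [|k IHk] s.
  by move=> les; exfalso; clear -les le1; lia.
have [->|nk0] := eqVneq k 0.
  by move=> les; exfalso; clear -les le1; lia.
have [->|nk1] := eqVneq k 1.
  move=> les [[|u [|v [|w [|? ?]]]] [//= _]].
  case/and4P=> /gappedP Ku /gappedP Kv /gappedP Kw _; rewrite addn0 addnA => E.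
  have [||i [j [Ki Kj Eij]]] :=
    kept_low_triple p_gt0 lt_pq q_le Ku Kv Kw.
  - by clear -les E le1; lia.
  - by move=> [p2 [q3 _]]; apply: not23.
  by exists [:: i; j]; split; rewrite /= ?addn0 ?Eij // !(introT (gappedP _ _ _ _)).
move=> les [[|u [|v [|w [|z l]]]] [//= szl]]; try by clear -szl nk0 nk1; lia.
case/and5P=> /gappedP Ku /gappedP Kv /gappedP Kw /gappedP Kz Kl suml.
have [a [b [c [Ka Kb Kc E]]]] := kept_quadruple Ku Kv Kw Kz.
have Kabc : all (gapped e p q) [:: a, b, c & l].
  by rewrite /= !(introT (gappedP _ _ _ _)).
case: E => E.
  by exists [:: a, b, c & l]; split => //=; clear -E suml szl; lia.
have [||r [szr Kr sr]] := IHk (s - (e - 1)).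
- have : 2 * (e - 1) <= k * (e - 1) by rewrite leq_mul //; clear -nk0 nk1; lia.
  by move: les; rewrite mulSn; clear -q_le lt_pq; lia.
- by exists [:: a, b, c & l]; split => //=; clear -E suml szl; lia.
exists (e - 1 :: r); split => //=; [by rewrite szr | | by clear -sr E suml; lia].
rewrite Kr andbT; apply/gappedP.
by clear -q_le lt_pq; lia.
Qed.

End Sums.

Lemma sumn_le_size (l : seq nat) c : all (fun x => x <= c) l -> sumn l <= size l * c.
Proof. by elim: l => //= x l IHl /andP[xc /IHl]; rewrite mulSn; lia. Qed.

(** * The combinatorics of the semigroup *)

Section Steps.
Variables e m n : nat.
Hypotheses (m_gt0 : 0 < m) (lt_mn : m < n) (n_le : n <= e - 2).
Local Notation D := (2 * e - 1).
Local Notation kept := (gapped e (e - 1 - n) (e - 1 - m)).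

(** The second coordinates of the generators. All generators lie on the line
    a + b = D, so these determine them. *)
Definition step b := kept b || (b == D).

Definition in_Sbar a b :=
  exists l, [/\ all step l, sumn l = b & a + b = size l * D].

(** If b + D is a sum of steps one of which is D, drop it. Otherwise that sum
    shows that b is small compared with the number k of steps allowed, and the sum
    for b, which may use k + 1 steps, can be shortened by
    kept_sum_shorten once its copies of D are set aside. *)
Lemma in_Sbar_cancel a b : (m, n) <> (e - 4, e - 3) ->
  in_Sbar (a + D) b -> in_Sbar a (b + D) -> in_Sbar a b.
Proof.
move=> good [l [Sl suml sizel]] [l' [Sl' suml' sizel']].
have D_gt0 : 0 < D by lia.
have [Dl'|nDl'] := boolP (D \in l').
  have pl' := perm_to_rem Dl'.
  exists (rem D l'); split.
  - by move: Sl'; rewrite (perm_all _ pl') /= => /andP[].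
  - by move: suml'; rewrite (perm_sumn pl') /=; lia.
  - by move: sizel'; rewrite (perm_size pl') /= mulSn; lia.
have Kl' : all (fun x => x <= e - 1) l'.
  apply/allP=> x xl'; have := allP Sl' _ xl'; rewrite /step /gapped.
  by case/orP => [|/eqP xD]; [lia | rewrite -xD xl' in nDl'].
have sz' : size l' = size l.
  by apply/eqP; rewrite -(eqn_pmul2r D_gt0); apply/eqP; lia.
have := sumn_le_size Kl'; rewrite suml' sz' => bD.
pose l1 := filter kept l; pose j := count (predC kept) l.
have Kl1 : all kept l1 by apply: filter_all.
have szl : size l = size l1 + j by rewrite size_filter /j count_predC.
have suml1 : sumn l = sumn l1 + j * D.
  rewrite /l1 /j; elim: (l) Sl => //= x r IHr /andP[Sx /IHr ->].
  case: ifP Sx => Kx; rewrite /step Kx /=; first lia.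
  by move=> /eqP->; rewrite mulSn; lia.
have [k szk] : exists k, size l = k.+1.
  by case: (size l) sizel => [|k]; [lia | exists k].
have jk : j <= k.
  rewrite leqNgt; apply/negP => kj; have : k.+1 * D <= j * D by rewrite leq_mul.
  have : k.+1 * (e - 1) <= k.+1 * D by rewrite leq_mul //; lia.
  by move: bD; rewrite szk; lia.
have {}bD : sumn l1 + j * D + D <= k.+1 * (e - 1) by move: bD; rewrite szk; lia.
have kj : k = (k - j) + j by lia.
have [||||||r [szr Kr sr]] := @kept_sum_shorten e (e - 1 - n) (e - 1 - m) _ _ _ _
    (k - j) (sumn l1).
- lia.
- lia.
- lia.
- by move=> [? ?]; apply: good; congr pair; lia.
- have : j * (e - 1) <= j * D by rewrite leq_mul //; lia.
  by move: bD; rewrite mulSn mulnBl; clear -n_le lt_mn; lia.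
- by exists l1; split => //; lia.
exists (r ++ nseq j D); split.
- rewrite all_cat all_nseq; apply/andP; split; last by rewrite /step eqxx !orbT.
  by apply: sub_all Kr => x Kx; rewrite /step Kx.
- by rewrite sumn_cat sumn_nseq sr -suml suml1 [D * j]mulnC.
- by rewrite size_cat size_nseq szr; move: sizel; rewrite szk mulSn -kj; lia.
Qed.

End Steps.

(** Here the steps are 0, 1, 4, ..., e - 1 and 2 e - 1. The total 3 is not a sum of two
    steps although it is a sum of three, so the point (4 e - 5, 3) of degree
    2 (2 e - 1) lies outside. For e = 5 its translate by the generator (5, 4) still lies
    outside, because 7 is not a sum of three elements of 0, 1, 4, 9; that
    translate is then the point to take. *)
Lemma in_Sbar_socle e : 5 <= e -> exists a b,
  ~ in_Sbar e (e - 4) (e - 3) a b /\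
  forall s, step e (e - 4) (e - 3) s ->
    in_Sbar e (e - 4) (e - 3) (a + (2 * e - 1 - s)) (b + s).
Proof.
move=> e5; have [-> {e5 e}|ne5] := eqVneq e 5.
  exists 20, 7; split.
    move=> [[|u [|v [|w [|z l]]]] [/= Sl suml szl]]; try lia.
    by move: Sl; rewrite /step /gapped /=; lia.
  rewrite /step /gapped => s Ss.
  have [s0|ns0] := eqVneq s 0.
    by exists [:: 4; 1; 1; 1]; subst s.
  have [s1|ns1] := eqVneq s 1.
    by exists [:: 4; 4; 0; 0]; subst s.
  have [s4|ns4] := eqVneq s 4.
    by exists [:: 9; 1; 1; 0]; subst s.
  have s9 : s = 9 by lia.
  by exists [:: 4; 4; 4; 4]; subst s.
exists (4 * e - 5), 3; split.
  move=> [[|u [|v [|w l]]] [/= Sl suml szl]]; try lia; last nia.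
  by move: Sl; rewrite /step /gapped /=; lia.
have S l : all (gapped e 2 3) l -> all (step e (e - 4) (e - 3)) l.
  by apply: sub_all => x; rewrite /step /gapped; lia.
move=> s; rewrite {1}/step /gapped => Ss.
have [s0|ns0] := eqVneq s 0.
  by exists [:: 1; 1; 1];
    split; [apply: (S); rewrite /= /gapped; lia | rewrite /=; lia | rewrite /=; lia].
have [sD|nsD] := eqVneq s (2 * e - 1).
  by exists [:: e - 1; e - 1; 4];
    split; [apply: (S); rewrite /= /gapped; lia | rewrite /=; lia | rewrite /=; lia].
have [s1|ns1] := leqP s (e - 4).
  by exists [:: s + 3; 0; 0];
    split; [apply: (S); rewrite /= /gapped; lia | rewrite /=; lia | rewrite /=; lia].
have [s2|ns2] := eqVneq s (e - 1).
  by exists [:: e - 2; 4; 0];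
    split; [apply: (S); rewrite /= /gapped; lia | rewrite /=; lia | rewrite /=; lia].
exists [:: e - 1; 1; s + 3 - e];
  split; [apply: (S); rewrite /= /gapped; lia | rewrite /=; lia | rewrite /=; lia].
Qed.

Local Open Scope ring_scope.

(** * Monomials in two variables *)

Lemma bidegree_eta (c : 'X_{1..2}) : bidegree (c ord0) (c ord_max) = c.
Proof.
by apply/mnmP => -[[|[|//]] lt2]; rewrite multinomE (tnth_nth 0%N) /=;
  congr (c _); apply: val_inj.
Qed.

Lemma bidegree0E a b : bidegree a b ord0 = a.
Proof. by rewrite multinomE (tnth_nth 0%N). Qed.

Lemma bidegree1E a b : bidegree a b ord_max = b.
Proof. by rewrite multinomE (tnth_nth 0%N). Qed.

Lemma bidegreeD a b a' b' :
  (bidegree a b + bidegree a' b')%MM = bidegree (a + a') (b + b').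
Proof. by rewrite -[LHS]bidegree_eta !mnmDE !bidegree0E !bidegree1E. Qed.

Lemma bidegree00 : bidegree 0 0 = 0%MM.
Proof. by rewrite -[RHS]bidegree_eta !mnm0E. Qed.

Lemma mdeg_bidegree a b : mdeg (bidegree a b) = (a + b)%N.
Proof.
by rewrite mdegE big_ord_recl big_ord1 bidegree0E; congr (_ + _)%N.
Qed.

(** * Regular sequences and algebraic independence *)

Section Chains.
Variable L : comNzRingType.
Implicit Types (I J : L -> Prop) (s : seq L).

(** The unit ideal is included: in_ideal_gen may well be everything. *)
Definition ideal_prop I :=
  [/\ I 0, forall x y, I x -> I y -> I (x + y) & forall a x, I x -> I (a * x)].

Lemma ideal_propB I x y : ideal_prop I -> I x -> I y -> I (x - y).
Proof. by move=> [_ ID IM] Ix Iy; rewrite -[- y]mulN1r; apply: ID => //; apply: IM. Qed.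

Lemma pred_ideal_prop (I : idealr L) : ideal_prop (fun x => x \in I).
Proof. by split=> [|x y|a x]; [apply: rpred0 | apply: rpredD | apply: idealMr]. Qed.

Lemma in_ideal_gen_nil (x : L) : @in_ideal_gen L [::] x <-> x = 0.
Proof.
split=> [[c ->]|->]; first by rewrite big_ord0.
by exists (fun=> 0); rewrite big_ord0.
Qed.

Lemma in_ideal_gen_rcons (s : seq L) (a x : L) :
  in_ideal_gen (rcons s a) x <-> exists c y, in_ideal_gen s y /\ x = y + c * a.
Proof.
split=> [[c ->]|[c [y [[d ->] ->]]]].
  rewrite size_rcons big_ord_recr /= nth_rcons ltnn eqxx.
  exists (c (size s)), (\sum_(i < size s) c i * s`_i); split; first by exists c.
  by congr (_ + _); apply: eq_bigr => i _; rewrite nth_rcons ltn_ord.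
exists (fun i => if (i < size s)%N then d i else c).
rewrite size_rcons big_ord_recr /= nth_rcons !ltnn eqxx.
by congr (_ + _); apply: eq_bigr => i _; rewrite nth_rcons ltn_ord.
Qed.

Lemma in_ideal_gen1 (a x : L) : @in_ideal_gen L [:: a] x <-> exists c, x = c * a.
Proof.
split=> [/(@in_ideal_gen_rcons [::])[c [y [/in_ideal_gen_nil -> ->]]]|[c ->]].
  by exists c; rewrite add0r.
by apply/(@in_ideal_gen_rcons [::]); exists c, 0; split;
  [apply/in_ideal_gen_nil | rewrite add0r].
Qed.

Lemma in_ideal_gen_ideal s : ideal_prop (in_ideal_gen s).
Proof.
split=> [|x y [c ->] [d ->]|a x [c ->]].
- by exists (fun=> 0); rewrite big1 // => i _; rewrite mul0r.
- exists (fun i => c i + d i); rewrite -big_split.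
  by apply: eq_bigr => i _; rewrite mulrDl.
- exists (fun i => a * c i); rewrite mulr_sumr.
  by apply: eq_bigr => i _; rewrite mulrA.
Qed.

Lemma in_ideal_gen_takeS i s x : (i < size s)%N ->
  in_ideal_gen (take i s) x -> in_ideal_gen (take i.+1 s) x.
Proof.
move=> lti sx; rewrite (take_nth 0 lti); apply/in_ideal_gen_rcons.
by exists 0, x; rewrite mul0r addr0.
Qed.

Lemma in_ideal_gen_take_nth i s : (i < size s)%N ->
  in_ideal_gen (take i.+1 s) s`_i.
Proof.
move=> lti; rewrite (take_nth 0 lti); apply/in_ideal_gen_rcons.
exists 1, 0; rewrite mul1r add0r; split => //.
by have [] := in_ideal_gen_ideal (take i s).
Qed.

Lemma in_ideal_gen_take i s x : in_ideal_gen (take i s) x -> in_ideal_gen s x.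
Proof.
move=> sx; have [le|lt] := leqP (size s) i; first by rewrite take_oversize in sx.
suff H k : (i <= k)%N -> (k <= size s)%N -> in_ideal_gen (take k s) x.
  by rewrite -[s]take_size; apply: H => //; apply: ltnW.
elim: k => [|k IHk]; first by rewrite leqn0 => /eqP <-.
rewrite leq_eqVlt => /predU1P[<- //|ltik] ltks.
by apply: in_ideal_gen_takeS => //; apply: IHk => //; apply: ltnW.
Qed.

(** The constant term b_0 is congruent to the sum modulo f, so it lies in J, hence
    vanishes, and then f can be cancelled modulo I. In the applications b_i is the value
    of a polynomial and T i says that this polynomial itself is zero. *)
Lemma peel_powers I J f (T : nat -> Prop) N (b : nat -> L) :
    ideal_prop J -> (forall x, I x -> J x) -> J f ->
    (forall x, I (f * x) -> I x) ->
    (forall i, J (b i) -> T i) -> (forall i, T i -> b i = 0) ->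
  I (\sum_(i < N) b i * f ^+ i) -> forall i, (i < N)%N -> T i.
Proof.
move=> idJ IJ Jf nzd.
elim: N b T => [|N IHN] b T JT T0 // Ib.
have [_ _ JM] := idJ.
have E : \sum_(i < N.+1) b i * f ^+ i = b 0%N + f * \sum_(i < N) b i.+1 * f ^+ i.
  rewrite big_ord_recl /= expr0 mulr1 mulr_sumr; congr (_ + _).
  by apply: eq_bigr => i _; rewrite exprS mulrCA.
have T_0 : T 0%N.
  apply: JT; have := ideal_propB idJ (IJ _ Ib) (JM (\sum_(i < N) b i.+1 * f ^+ i) _ Jf).
  by rewrite E mulrC addrK.
case=> // i; rewrite ltnS; apply: (IHN (b \o succn) (T \o succn)) => /=.
- by move=> j; apply: JT.
- by move=> j; apply: T0.
- by apply: nzd; move: Ib; rewrite E (T0 _ T_0) add0r.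
Qed.

(** A regular sequence is algebraically independent over any field
    contained in the ring. The chain I stands for the ideals
    generated by the initial segments of the sequence z, but may
    also be a chain of primes with z i in I i.+1 and not in I i: both a long regular
    sequence and a long chain of primes produce algebraically independent elements. *)
Lemma chain_alg_indep (K : fieldType) (phi : {rmorphism K -> L})
    (I : nat -> L -> Prop) (z : nat -> L) N (c : nat -> nat -> nat -> K) :
    (forall i, (i <= 3)%N -> ideal_prop (I i)) ->
    (forall i x, (i < 3)%N -> I i x -> I i.+1 x) ->
    (forall i, (i < 3)%N -> I i.+1 (z i)) ->
    (forall i x, (i < 3)%N -> I i (z i * x) -> I i x) ->
    ~ I 3 1 ->
    \sum_(i < N) (\sum_(j < N) (\sum_(k < N) phi (c i j k) * z 2%N ^+ k)
       * z 1%N ^+ j) * z 0%N ^+ i = 0 ->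
  forall i j k, (i < N)%N -> (j < N)%N -> (k < N)%N -> c i j k = 0.
Proof.
move=> idI subI Iz nzd I31 sum0 i j k iN jN kN.
pose T1 i j := forall k, (k < N)%N -> c i j k = 0.
pose T0 i := forall j, (j < N)%N -> T1 i j.
have T1s i' j' : T1 i' j' -> \sum_(k < N) phi (c i' j' k) * z 2%N ^+ k = 0.
  by move=> T1ij; rewrite big1 // => k' _; rewrite T1ij // rmorph0 mul0r.
have T0s i' : T0 i' ->
    \sum_(j < N) (\sum_(k < N) phi (c i' j k) * z 2%N ^+ k) * z 1%N ^+ j = 0.
  by move=> T0i; rewrite big1 // => j' _; rewrite T1s ?mul0r //; apply: T0i.
have JT0 i' : I 1%N (\sum_(j < N) (\sum_(k < N) phi (c i' j k) * z 2%N ^+ k) *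
    z 1%N ^+ j) -> T0 i'.
  apply: (@peel_powers (I 1%N) (I 2%N) (z 1%N) (T1 i') N _ (idI 2%N isT)
    (fun x => subI 1%N x isT) (Iz 1%N isT) (fun x => nzd 1%N x isT) _ (T1s i')).
  move=> j'.
  apply: (@peel_powers (I 2%N) (I 3%N) (z 2%N) (fun k => c i' j' k = 0) N
    (fun k => phi (c i' j' k)) (idI 3%N isT) (fun x => subI 2%N x isT) (Iz 2%N isT)
    (fun x => nzd 2%N x isT)); last by move=> k' ->; rewrite rmorph0.
  move=> k' Ick; apply/eqP/negP => /negP ck; apply: I31.
  have [_ _ /(_ (phi (c i' j' k')^-1) _ Ick)] := idI 3%N isT.
  by rewrite -rmorphM mulVf // rmorph1.
have : I 0%N (\sum_(i < N) (\sum_(j < N) (\sum_(k < N) phi (c i j k) * z 2%N ^+ k)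
       * z 1%N ^+ j) * z 0%N ^+ i) by rewrite sum0; have [] := idI 0%N isT.
move=> sumI; exact: (@peel_powers (I 0%N) (I 1%N) (z 0%N) T0 N _ (idI 1%N isT)
  (fun x => subI 0%N x isT) (Iz 0%N isT) (fun x => nzd 0%N x isT) JT0 T0s sumI
  i iN j jN k kN).
Qed.

End Chains.

Lemma linear_dependence (K : fieldType) (I J : finType) (A : I -> J -> K) :
  (#|J| < #|I|)%N ->
  exists2 c : I -> K, exists i, c i != 0 & forall j, \sum_i c i * A i j = 0.
Proof.
move=> ltJI; pose B := \matrix_(i < #|I|, j < #|J|) A (enum_val i) (enum_val j).
have : kermx B != 0.
  by rewrite -mxrank_eq0 mxrank_ker subn_eq0 -ltnNge (leq_ltn_trans (rank_leq_col _)).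
case/rowV0Pn => v /sub_kermxP vB /rV0Pn[i vi].
exists (fun i => v 0 (enum_rank i)); first by exists (enum_val i); rewrite enum_valK.
move=> j; have /rowP/(_ (enum_rank j)) := vB; rewrite !mxE => E; rewrite -[RHS]E.
rewrite (reindex_onto enum_val enum_rank) /=; last by move=> *; apply: enum_rankK.
apply: eq_big => [k|k _]; first by rewrite enum_valK eqxx.
by rewrite !mxE enum_valK enum_rankK.
Qed.

(** The N ^ 3 monomials in f, g, h with exponents below N have degree less than N * d,
    where d depends on f, g, h only, so they lie in a space of
    dimension (N * d) ^ 2 < N ^ 3. *)
Lemma alg_dep (K : fieldType) (f g h : {mpoly K[2]}) :
  exists N (c : nat -> nat -> nat -> K),
    (exists i j k, [/\ (i < N)%N, (j < N)%N, (k < N)%N & c i j k != 0]) /\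
    \sum_(i < N) (\sum_(j < N) (\sum_(k < N) (c i j k)%:A * h ^+ k) * g ^+ j)
       * f ^+ i = 0 :> {mpoly K[2]}.
Proof.
pose d := (msize f + msize g + msize h).+1.
pose N := (d ^ 2).+1.
have Nd : ((N * d) ^ 2 < N ^ 3)%N.
  rewrite expnMn [X in (_ < X)%N]expnS [X in (_ < X)%N]mulnC.
  by rewrite ltn_mul2l expn_gt0 /= /N ltnSn.
pose I := ('I_N * 'I_N * 'I_N)%type.
pose J := ('I_(N * d) * 'I_(N * d))%type.
pose mon (i : I) : {mpoly K[2]} := f ^+ i.1.1 * g ^+ i.1.2 * h ^+ i.2.
pose A (i : I) (j : J) : K := (mon i)@_(bidegree j.1 j.2).
have [|c [[[i j] k] cijk] csum] := @linear_dependence K I J A.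
  by rewrite !card_prod !card_ord mulnn -mulnA mulnn -expnS.
pose c' (i j k : nat) := c (inord i, inord j, inord k).
exists N, c'; split.
  by exists i, j, k; split=> //; rewrite /c' !inord_val.
have mexp (p : {mpoly K[2]}) (n : 'I_N) x :
    x \in msupp (p ^+ n) -> (mdeg x <= N * msize p)%N.
  move=> xp; have [p0|p0] := eqVneq p 0.
    move: xp; rewrite p0; case: (n : nat) => [|l]; last by rewrite expr0n msupp0.
    by rewrite expr0 msupp1 inE => /eqP->; rewrite mdeg0.
  have := msize_mdeg_lt xp; rewrite -mlead_deg ?expf_neq0 // mleadX // mdegMn ltnS.
  move=> xn; apply: leq_trans xn _; rewrite mulnC leq_mul //; first exact: ltnW.
  by rewrite -(mlead_deg p0).
have smallm i' x : x \in msupp (mon i') -> (mdeg x < N * d)%N.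
  case: i' => -[a b] e /= /msuppM_le/allpairsP[[x1 x2] /= [/msuppM_le xfg xh ->]].
  case/allpairsP: xfg => -[x3 x4] /= [xf xg ->]; rewrite !mdegD.
  have := mexp f a x3 xf; have := mexp g b x4 xg; have := mexp h e x2 xh.
  by rewrite /d mulnS !mulnDr /N; lia.
apply/mpolyP => x; rewrite mcoeff0.
have -> : \sum_(i < N) (\sum_(j < N) (\sum_(k < N) (c' i j k)%:A * h ^+ k)
      * g ^+ j) * f ^+ i = \sum_i c i *: mon i.
  transitivity (\sum_i \sum_j \sum_k c (i, j, k) *: mon (i, j, k)); last first.
    by rewrite pair_bigA pair_bigA /=; apply: eq_bigr => -[[]].
  apply: eq_bigr => a _; rewrite mulr_suml; apply: eq_bigr => b _.
  rewrite !mulr_suml; apply: eq_bigr => e _.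
  rewrite /c' !inord_val /mon /= -!scalerAl mul1r; congr (_ *: _).
  ring.
rewrite raddf_sum /=.
under eq_bigr do rewrite mcoeffZ.
have [xs|xl] := ltnP (mdeg x) (N * d).
  have x0 : (x ord0 < N * d)%N.
    by apply: leq_ltn_trans xs; rewrite mdegE big_ord_recl leq_addr.
  have x1 : (x ord_max < N * d)%N.
    by apply: leq_ltn_trans xs; rewrite mdegE big_ord_recr leq_addl.
  by rewrite -(bidegree_eta x) -[RHS](csum (Ordinal x0, Ordinal x1)).
rewrite big1 // => i' _; rewrite memN_msupp_eq0 ?mulr0 //.
by apply/negP => /smallm; rewrite ltnNge xl.
Qed.

(** * Localization at a prime ideal *)

Section LocalRing.
Variables (R : idomainType) (P : prime_idealr R).
Local Notation L := (localization P).

Fact loc_subproof (a : R) : tofrac a \in localization_pred P.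
Proof. by apply/asboolP; exists a, 1; rewrite idealr1 rmorph1 divr1. Qed.

Definition loc (a : R) : L := Localization (loc_subproof a).

Fact loc_zmod_morphism : zmod_morphism loc.
Proof. by move=> a b; apply: val_inj; rewrite /= rmorphB. Qed.

Fact loc_monoid_morphism : monoid_morphism loc.
Proof. by split=> [|a b]; apply: val_inj; rewrite /= ?rmorph1 ?rmorphM. Qed.

HB.instance Definition _ := GRing.isZmodMorphism.Build R L loc loc_zmod_morphism.
HB.instance Definition _ := GRing.isMonoidMorphism.Build R L loc loc_monoid_morphism.

Lemma loc_inj : injective loc.
Proof. by move=> a b /(congr1 val)/= /eqP; rewrite tofrac_eq => /eqP. Qed.

Lemma loc_unit s : s \notin P -> exists v, loc s * v = 1.
Proof.
move=> sP; have vP : (tofrac s)^-1 \in localization_pred P.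
  by apply/asboolP; exists 1, s; rewrite rmorph1 div1r.
exists (Localization vP); apply: val_inj; rewrite /= divff // tofrac_eq0.
by apply: contraNneq sP => ->; rewrite idealr0.
Qed.

Lemma loc_frac (z : L) : exists a s, s \notin P /\ loc s * z = loc a.
Proof.
have /asboolP[a [s [sP zE]]] := valP z; exists a, s; split=> //.
apply: val_inj; rewrite /= zE mulrCA divff ?mulr1 // tofrac_eq0.
by apply: contraNneq sP => ->; rewrite idealr0.
Qed.

Lemma loc_mul_eq0 (x y : L) : x * y = 0 -> x = 0 \/ y = 0.
Proof.
move=> /(congr1 val)/= /eqP; rewrite mulf_eq0.
by case/orP => /eqP xy; [left | right]; apply: val_inj.
Qed.

Definition loc_max : {pred L} :=
  fun z => `[< exists a s, [/\ s \notin P, a \in P & loc s * z = loc a] >].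

Lemma loc_maxE a : (loc a \in loc_max) = (a \in P).
Proof.
apply/idP/idP => [/asboolP[b [s [sP bP]]]|aP].
  by rewrite -rmorphM => /loc_inj E; rewrite -E prime_idealrM (negPf sP) in bP.
by apply/asboolP; exists a, 1; rewrite idealr1 rmorph1 mul1r.
Qed.

Lemma loc_max_ideal : idealr_closed loc_max.
Proof.
split; first by rewrite -(rmorph0 loc) loc_maxE idealr0.
  by rewrite -(rmorph1 loc) loc_maxE idealr1.
move=> z x y /asboolP[a [s [sP aP xE]]] /asboolP[b [t [tP bP yE]]].
have [c [u [uP zE]]] := loc_frac z.
apply/asboolP; exists (c * a * t + b * u * s), (u * s * t); split.
- by rewrite !prime_idealrM !negb_or uP sP tP.
- by rewrite rpredD // -mulrA; [apply: idealMr; rewrite mulrC; apply: idealMr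
    | rewrite mulrC; apply: idealMr].
- rewrite rmorphD !rmorphM /= -xE -yE -zE; ring.
Qed.

Lemma loc_maxN z : z \notin loc_max -> exists w, z * w = 1.
Proof.
move=> zM; have [a [s [sP zE]]] := loc_frac z.
have aP : a \notin P by apply: contra zM => aP; apply/asboolP; exists a, s.
have [v av] := loc_unit aP.
by exists (loc s * v); rewrite mulrA [z * _]mulrC zE.
Qed.

Lemma loc_max_max (J : {pred L}) : idealr_closed J -> {subset J <= loc_max}.
Proof.
move=> [J0 J1 JM] z zJ; apply: contraNT J1 => /loc_maxN[w zw].
by rewrite -zw mulrC -[_ * _]addr0; apply: JM.
Qed.

Lemma loc_max_maximal : maximal_ideal loc_max.
Proof. by split=> [|J Jid _]; [apply: loc_max_ideal | apply: loc_max_max]. Qed.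

Lemma loc_max_unique (N : {pred L}) : maximal_ideal N -> N =i loc_max.
Proof.
move=> [Nid Nmax] z; apply/idP/idP; first exact: loc_max_max.
by apply: (Nmax _ loc_max_ideal); apply: loc_max_max.
Qed.

End LocalRing.

Arguments loc_max {R} P z : simpl never.
Arguments loc {R} P a : simpl never.
Arguments loc_inj {R} P [x1 x2].

(** * Dimension and depth of local rings *)

Section Primes.
Variable L : comNzRingType.
Implicit Types (J : {pred L}) (f g : L).

Lemma prime_idealr_of J : idealr_closed J -> prime_idealr_closed J ->
  exists P : prime_idealr L, P =i J.
Proof.
move=> Jid Jpr.
pose P : prime_idealr L := HB.pack (J : L -> bool) (isIdealr.Build L J Jid)
  (isPrimeIdealrClosed.Build L J Jpr).
by exists P.
Qed.

Definition avoids_powers g J := forall k, g ^+ k \notin J.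

Lemma maximal_avoiding_ideal J g : idealr_closed J -> avoids_powers g J ->
  exists J', [/\ idealr_closed J', avoids_powers g J', {subset J <= J'} &
    forall I, idealr_closed I -> avoids_powers g I -> {subset J' <= I} ->
      {subset I <= J'}].
Proof.
move=> Jid Jg.
pose T := {I : L -> bool | [/\ idealr_closed I, avoids_powers g I & {subset J <= I}]}.
have JT : [/\ idealr_closed J, avoids_powers g J & {subset J <= J}] by split.
pose R (s t : T) : bool := `[< {subset sval s <= sval t} >].
have [| | |[J' [J'id J'g JJ']] J'max] :=
    @classical_sets.ZL_preorder T (exist _ J JT) (fun s t => R s t).
- by move=> t; apply/asboolP.
- move=> r s t /asboolP rs /asboolP st; apply/asboolP => x xr.
  by apply: st; apply: rs.
- move=> A Atot; have [[t0 At0]|nA] := pselect (exists t, A t); last first.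
    by exists (exist _ J JT) => s As; case: nA; exists s.
  pose U : {pred L} := fun x => `[< exists2 t, A t & x \in sval t >].
  have UT : [/\ idealr_closed U, avoids_powers g U & {subset J <= U}].
    split; [split | |].
    - by apply/asboolP; exists t0 => //; case: (svalP t0) => -[].
    - apply/asboolP => -[t At t1]; case: (svalP t) => _ /(_ 0%N) + _.
      by rewrite expr0 t1.
    - move=> a x y /asboolP[s As xs] /asboolP[t At yt]; apply/asboolP.
      case: (Atot _ _ As At) => /asboolP st.
        by exists t => //; case: (svalP t) => -[_ _ tM] _ _; apply: tM => //; apply: st.
      by exists s => //; case: (svalP s) => -[_ _ sM] _ _; apply: sM => //; apply: st.
    - move=> k; apply/asboolP => -[t At tk]; case: (svalP t) => _ /(_ k) + _.
      by rewrite tk.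
    - by move=> x xJ; apply/asboolP; exists t0 => //; case: (svalP t0) => _ _; apply.
  exists (exist _ U UT) => s As; apply/asboolP => x xs /=.
  by apply/asboolP; exists s.
exists J'; split=> // I Iid Ig J'I.
have IT : [/\ idealr_closed I, avoids_powers g I & {subset J <= I}].
  by split=> // x xJ; exact: (J'I _ (JJ' _ xJ)).
by have /asboolP := J'max (exist _ I IT) (asboolT J'I).
Qed.

(** An ideal I maximal among those containing J and no power of g is prime: for u and v
    outside I, both I + (u) and I + (v) contain a power of g, hence so does I + (u v). *)
Lemma prime_avoiding_powers J g : idealr_closed J -> avoids_powers g J ->
  exists2 P : prime_idealr L, {subset J <= P} & g \notin P.
Proof.
move=> Jid Jg; have [I [Iid Ig JI Imax]] := maximal_avoiding_ideal Jid Jg.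
have [I0 I1 IM] := Iid.
have ID x y : x \in I -> y \in I -> x + y \in I.
  by move=> xI yI; rewrite -[x]mul1r; apply: IM.
have IMl a x : x \in I -> a * x \in I.
  by move=> xI; rewrite -[_ * _]addr0; apply: IM.
have key u : u \notin I -> exists k c j, j \in I /\ g ^+ k = j + c * u.
  move=> uI; apply: contrapT => nk.
  pose Iu : {pred L} := fun x => `[< exists c j, j \in I /\ x = j + c * u >].
  have IuS x : x \in I -> x \in Iu.
    by move=> xI; apply/asboolP; exists 0, x; rewrite mul0r addr0.
  have Iug : avoids_powers g Iu.
    move=> k; apply/asboolP => -[c [j [jI E]]]; apply: nk; by exists k, c, j.
  have Iuid : idealr_closed Iu.
    split; [exact: IuS | by rewrite -(expr0 g); apply: Iug |].
    move=> a x y /asboolP[c [j [jI ->]]] /asboolP[d [i [iI ->]]].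
    apply/asboolP; exists (a * c + d), (a * j + i); split; first exact: IM.
    ring.
  have uIu : u \in Iu by apply/asboolP; exists 1, 0; rewrite add0r mul1r.
  by rewrite (Imax _ Iuid Iug IuS _ uIu) in uI.
have Ipr : prime_idealr_closed I.
  move=> u v uvI; apply/negPn/negP; rewrite negb_or => /andP[/key[k [c [i [iI ki]]]]].
  move=> /key[l [d [j [jI lj]]]].
  have /negP := Ig (k + l)%N; apply; rewrite exprD ki lj.
  have -> : (i + c * u) * (j + d * v) = (j + d * v) * i + ((c * u) * j + (c * d) * (u * v)).
    ring.
  by apply: (ID); [apply: IMl | apply: (ID); apply: IMl].
have [P PI] := prime_idealr_of Iid Ipr.
exists P; first by move=> x xJ; rewrite PI; apply: JI.
by rewrite PI -(expr1 g).
Qed.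

Definition principal f : {pred L} := fun x => `[< exists c, x = c * f >].

Lemma principal_ideal f : 1 \notin principal f -> idealr_closed (principal f).
Proof.
split=> //; first by apply/asboolP; exists 0; rewrite mul0r.
move=> a x y /asboolP[c ->] /asboolP[d ->]; apply/asboolP.
by exists (a * c + d); rewrite mulrDl mulrA.
Qed.

(** A prime containing f but not g sits strictly between 0 and the ideal Q of
    nonunits. *)
Lemma prime_chain2 (Q : {pred L}) f g :
    (forall x y : L, x * y = 0 -> x = 0 \/ y = 0) ->
    idealr_closed Q -> prime_idealr_closed Q ->
    (forall J, idealr_closed J -> {subset J <= Q}) ->
    f != 0 -> g \in Q -> avoids_powers g (principal f) ->
  exists c, @prime_chain L 2 c.
Proof.
move=> dom Qid Qpr Qmax f0 gQ fg.
have [P fP gP] := prime_avoiding_powers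
  (principal_ideal (fg 0%N)) fg.
have [Q' Q'E] := prime_idealr_of Qid Qpr.
pose Z : {pred L} := pred1 0.
have Zid : idealr_closed Z.
  split; [exact: eqxx | exact: oner_neq0 |].
  by move=> a x y /eqP-> /eqP->; rewrite mulr0 addr0; apply/eqP.
have Zpr : prime_idealr_closed Z.
  by move=> u v /eqP/dom[->|->]; rewrite ?inE eqxx ?orbT.
have [Z' Z'E] := prime_idealr_of Zid Zpr.
exists (fun i => if i is 0%N then Z' else if i is 1%N then P else Q').
have fP1 : f \in P by apply: fP; apply/asboolP; exists 1; rewrite mul1r.
case=> [|[|//]] _ /=; split.
- by move=> x; rewrite Z'E => /eqP->; rewrite idealr0.
- by exists f => //; rewrite Z'E.
- move=> x xP; rewrite Q'E; apply: (Qmax P) => //.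
  split; [exact: idealr0 | by rewrite idealr1 |].
  by move=> a u v uP vP; rewrite rpredD // idealMr.
- by exists g => //; rewrite Q'E.
Qed.

End Primes.

Section LocalDimension.
Variables (R : idomainType) (P : prime_idealr R).
Local Notation L := (localization P).

Lemma loc_max_prime : prime_idealr_closed (loc_max P).
Proof.
move=> x y xyM; apply/negPn/negP; rewrite negb_or => /andP[/loc_maxN[u xu] /loc_maxN[v yv]].
have [_ /negP[]] := loc_max_ideal P; rewrite -[1]addr0.
have -> : 1 = (u * v) * (x * y) :> L.
  by rewrite mulrACA [u * _]mulrC [v * _]mulrC xu yv mulr1.
by have [M0 _ MM] := loc_max_ideal P; apply: MM.
Qed.

Lemma loc_prime_chain2 f g : f != 0 -> g \in P ->
    (forall k s a, s \notin P -> s * g ^+ k = a * f -> False) ->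
  exists c, @prime_chain L 2 c.
Proof.
move=> f0 gP fg; apply: (@prime_chain2 _ (loc_max P) (loc P f) (loc P g)).
- exact: loc_mul_eq0.
- exact: loc_max_ideal.
- exact: loc_max_prime.
- exact: loc_max_max.
- by apply: contraNneq f0 => f0; apply/eqP/(@loc_inj _ P); rewrite f0 rmorph0.
- by rewrite loc_maxE.
- move=> k; apply/asboolP => -[z gz]; have [a [s [sP zE]]] := loc_frac z.
  apply: (fg k s a sP); apply: (@loc_inj _ P).
  by rewrite !rmorphM rmorphXn /= gz -zE mulrA.
Qed.

(** Being a nonzerodivisor modulo f passes from the domain to its localization by
    clearing denominators. *)
Lemma loc_regular2 f g : f != 0 -> f \in P -> g \in P ->
    (forall a b, g * a = b * f -> exists c, a = c * f) ->
  regular_seq [:: loc P f; loc P g].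
Proof.
move=> f0 fP gP reg; split=> [[|[|//]] x _ /=|].
- rewrite !in_ideal_gen_nil => /loc_mul_eq0[E|//].
  by case/eqP: f0; apply: (@loc_inj _ P); rewrite E rmorph0.
- rewrite !in_ideal_gen1 => -[c gx].
  have [a [s [sP xE]]] := loc_frac x; have [b [t [tP cE]]] := loc_frac c.
  have [|d dE] := reg (t * a) (s * b).
    apply: (@loc_inj _ P); rewrite !rmorphM /= -xE -cE.
    transitivity (loc P t * loc P s * (loc P g * x)); first by ring.
    by rewrite gx; ring.
  have [|v stv] := @loc_unit _ P (s * t); first by rewrite prime_idealrM negb_or sP tP.
  exists (v * loc P d); rewrite -mulrA -rmorphM -dE rmorphM /= -xE.
  by rewrite -[LHS]mul1r -stv rmorphM /=; ring.
- move=> /(@in_ideal_gen_rcons _ [:: _])[c [y [/in_ideal_gen1[d ->] E]]].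
  have [_ /negP[]] := loc_max_ideal P; rewrite E.
  have [M0 _ MM] := loc_max_ideal P; apply: (MM); first by rewrite loc_maxE.
  by rewrite -[_ * _]addr0; apply: (MM); rewrite ?loc_maxE.
Qed.

(* R has transcendence degree at most two over K. *)
Variables (K : fieldType) (phi : {rmorphism K -> R}).
Hypothesis dep : forall f g h : R, exists N (c : nat -> nat -> nat -> K),
    (exists i j k, [/\ (i < N)%N, (j < N)%N, (k < N)%N & c i j k != 0]) /\
    \sum_(i < N) (\sum_(j < N) (\sum_(k < N) phi (c i j k) * h ^+ k) * g ^+ j)
       * f ^+ i = 0.

(** The denominators of the z i are units, so the z i can be replaced by elements
    of R. These would be algebraically independent by chain_alg_indep. *)
Lemma loc_no_chain3 (I : nat -> L -> Prop) (z : nat -> L) :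
    (forall i, (i <= 3)%N -> ideal_prop (I i)) ->
    (forall i x, (i < 3)%N -> I i x -> I i.+1 x) ->
    (forall i, (i < 3)%N -> I i.+1 (z i)) ->
    (forall i x, (i < 3)%N -> I i (z i * x) -> I i x) ->
    ~ I 3 1 -> False.
Proof.
move=> idI subI Iz nzd I31.
have [a azE] := choice (fun i => loc_frac (z i)).
have [N [c [[i [j [k [iN jN kN]]]] + sum0]]] := dep (a 0%N) (a 1%N) (a 2%N).
apply/negP; rewrite negbK; apply/eqP.
apply: (@chain_alg_indep L K (loc P \o phi) I (loc P \o a) N c) iN jN kN => //.
- move=> l l3 /=; have [s [_ <-]] := azE l.
  by have [_ _ IM] := idI l.+1 l3; apply: IM; apply: Iz.
- move=> l x l3 /=; have [s [sP <-]] := azE l; have [v sv] := loc_unit sP.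
  have [_ _ IM] := idI l (ltnW l3) => /(IM v) Ix; apply: nzd => //.
  by rewrite -[z l]mul1r -sv; move: Ix; congr (I l); ring.
- rewrite -[RHS](rmorph0 (loc P)) -sum0 rmorph_sum; apply: eq_bigr => i' _.
  rewrite rmorphM rmorphXn rmorph_sum; congr (_ * _); apply: eq_bigr => j' _.
  rewrite rmorphM rmorphXn rmorph_sum; congr (_ * _); apply: eq_bigr => k' _.
  by rewrite rmorphM rmorphXn.
Qed.

Lemma loc_krull_le2 k (c : nat -> prime_idealr L) : prime_chain k c -> (k <= 2)%N.
Proof.
move=> chain; rewrite leqNgt; apply/negP => k3.
have ex i : exists x, (i < 3)%N -> x \in c i.+1 /\ x \notin c i.
  have [i3|] := ltnP i 3; last by exists 0.
  by have [_ [x]] := chain i (leq_trans i3 k3); exists x.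
have [z zE] := choice ex.
apply: (@loc_no_chain3 (fun i x => x \in c i) z).
- by move=> i _; apply: pred_ideal_prop.
- by move=> i x i3; have [+ _] := chain i (leq_trans i3 k3); apply.
- by move=> i /zE[].
- by move=> i x /zE[_ zi]; rewrite prime_idealrM (negPf zi).
- by rewrite idealr1.
Qed.

Lemma loc_depth_le2 (s : seq L) : regular_seq s -> (size s <= 2)%N.
Proof.
move=> [reg s1]; rewrite leqNgt; apply/negP => s3.
apply: (@loc_no_chain3 (fun i => in_ideal_gen (take i s)) (nth 0 s)).
- by move=> i _; apply: in_ideal_gen_ideal.
- by move=> i x i3; apply: in_ideal_gen_takeS; apply: leq_trans s3.
- by move=> i i3; apply: in_ideal_gen_take_nth; apply: leq_trans s3.
- by move=> i x i3; apply: reg; apply: leq_trans s3.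
- by move=> /in_ideal_gen_take.
Qed.

(** Depth and dimension are at most two because three elements of R are algebraically
    dependent. A regular sequence f, g shows that the depth is two, and since no
    power of g then lies in (f), there is a chain 0 < P1 < max of primes. *)
Lemma loc_cohen_macaulay f g : f != 0 -> f \in P -> g \in P ->
    (forall a b, g * a = b * f -> exists c, a = c * f) ->
  cohen_macaulay_local L.
Proof.
move=> f0 fP gP reg; exists (loc_max P), 2; split.
- exact: loc_max_maximal.
- exact: loc_max_unique.
- split; last exact: loc_krull_le2.
  apply: (loc_prime_chain2 f0 gP) => k s a sP; elim: k a => [|k IHk] a.
    rewrite expr0 mulr1 => sE; move: sP; rewrite sE prime_idealrM fP orbT //.
  rewrite exprS mulrCA => /reg[c]; exact: IHk.
- split; last by move=> s _; apply: loc_depth_le2.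
  exists [:: loc P f; loc P g]; split=> //; last exact: loc_regular2.
  by move=> x; rewrite !inE => /orP[] /eqP->; rewrite loc_maxE.
Qed.

(** Suppose that the fraction w = r / q lies outside L although its product with every
    element of the maximal ideal lies in L. For a regular sequence a, b in the maximal
    ideal, b (a w) = a (b w) would put a w in a L and w in L. Hence the depth is at most
    one, whereas f and g give a chain of primes of length two. *)
Lemma loc_not_cohen_macaulay f g q r :
    f != 0 -> g \in P -> q != 0 ->
    (forall k s a, s \notin P -> s * g ^+ k = a * f -> False) ->
    (forall a, a \in P -> exists b, a * r = b * q) ->
    (forall s b, s \notin P -> s * r = b * q -> False) ->
  ~ cohen_macaulay_local L.
Proof.
move=> f0 gP q0 fg socle rq [M [d [Mmax _ [_ dimd] [[s [sd sM [reg s1]]] _]]]].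
have [c c2] := loc_prime_chain2 f0 gP fg.
have d2 := dimd _ _ c2; rewrite -sd in d2.
have ME := loc_max_unique Mmax.
have sP i : (i < 2)%N -> exists a t, [/\ t \notin P, a \in P & loc P t * s`_i = loc P a].
  move=> i2; apply/asboolP; rewrite -[`[< _ >]]/(s`_i \in loc_max P) -ME sM //.
  by rewrite mem_nth // (leq_trans i2).
have [a [t [tP aP aE]]] := sP 0%N isT; have [b [u [uP bP bE]]] := sP 1%N isT.
have [a' aE'] := socle a aP; have [b' bE'] := socle b bP.
have E : b * a' = a * b'.
  apply: (mulIf q0); rewrite -!mulrA -aE' -bE'; ring.
have s0 : s`_0 != 0.
  apply/eqP => s00; apply: s1; apply: (@in_ideal_gen_take _ 0).
  by apply: reg; [apply: leq_trans d2 | rewrite s00 mul0r take0; apply/in_ideal_gen_nil].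
have a0 : a != 0.
  apply: contraNneq s0 => a0; move: aE; rewrite a0 rmorph0 => /loc_mul_eq0[t0|->//].
  by move: tP; rewrite (@loc_inj _ P t 0) ?rmorph0 // idealr0.
have take1E : take 1 s = [:: s`_0] by case: (s) d2 => //= x l _; rewrite take0.
have [v tv] := loc_unit tP.
have [x xE] : exists x, loc P a' = x * s`_0.
  apply/in_ideal_gen1; rewrite -take1E; apply: reg => //.
  have [w uw] := loc_unit uP.
  rewrite take1E; apply/in_ideal_gen1; exists (w * loc P t * loc P b').
  transitivity ((loc P u * w) * (s`_1 * loc P a')); first by rewrite uw mul1r.
  transitivity (w * (loc P b * loc P a')); first by rewrite -bE; ring.
  by rewrite -rmorphM E rmorphM /= -aE; ring.
have {}xE : loc P a' = (x * v) * loc P a.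
  by rewrite xE -[s`_0]mul1r -tv -[in RHS]aE; ring.
have [y [w [wP wE]]] := loc_frac (x * v).
apply: (rq w y wP).
have {}xE : w * a' = y * a.
  by apply: (@loc_inj _ P); rewrite !rmorphM /= xE -wE mulrA.
apply: (mulIf a0); transitivity (w * (a * r)); first by ring.
by rewrite aE' mulrA xE; ring.
Qed.

End LocalDimension.

(** * Maximal ideals of algebras over an algebraically closed field *)

Lemma maximal_ideal_inv (R : comNzRingType) (M : idealr R) (g : R) :
  maximal_ideal M -> g \notin M -> exists u, g * u - 1 \in M.
Proof.
move=> [_ Mmax] gM; apply: contrapT => nu.
pose J : {pred R} := fun x => `[< exists c, x - g * c \in M >].
have Jid : idealr_closed J.
  split.
  - by apply/asboolP; exists 0; rewrite mulr0 subr0 rpred0.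
  - apply/asboolP => -[c cM]; apply: nu; exists c.
    by rewrite -opprB rpredN.
  - move=> a x y /asboolP[c cM] /asboolP[d dM]; apply/asboolP.
    exists (a * c + d).
    have -> : a * x + y - g * (a * c + d) = a * (x - g * c) + (y - g * d) by ring.
    by rewrite rpredD // idealMr.
case/negP: gM; apply: (Mmax J) => //.
  by move=> x xM; apply/asboolP; exists 0; rewrite mulr0 subr0.
by apply/asboolP; exists 1; rewrite mulr1 subrr rpred0.
Qed.

Section Nullstellensatz.
Variables (K : closedFieldType) (R : comNzRingType) (phi : {rmorphism K -> R}).
Variables (M : prime_idealr R) (T U : R) (gens : seq R).
Hypothesis Mmax : maximal_ideal M.
(* The algebra is spanned over K[T, U] by the list gens. *)
Hypothesis gensP : forall V : R -> Prop,
  V 0 -> (forall x y, V x -> V y -> V (x + y)) ->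
  (forall c x, V x -> V (phi c * x)) ->
  (forall i j g, g \in gens -> V (T ^+ i * U ^+ j * g)) -> forall x, V x.
Variable F : {poly {poly K}}.
Hypothesis F_neq0 : F != 0.

Local Notation ev q := (map_poly phi q).[T].
Hypothesis F_M : \sum_(j < size F) ev F`_j * U ^+ j \in M.

Lemma ev_root q : q != 0 -> ev q \in M -> exists c, T - phi c \in M.
Proof.
have [r {1 2}->] := closed_field_poly_normal q.
rewrite scale_poly_eq0 lead_coef_eq0 negb_or => /andP[q0 _].
have -> : ev (lead_coef q *: \prod_(z <- r) ('X - z%:P)) =
    phi (lead_coef q) * \prod_(z <- r) (T - phi z).
  rewrite map_polyZ hornerZ rmorph_prod horner_prod /=; congr (_ * _).
  by apply: eq_bigr => z _; rewrite rmorphB /= map_polyX map_polyC hornerXsubC.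
rewrite prime_idealrM => /orP[qM|].
  have := idealr1 M; rewrite -(rmorph1 phi) -(@mulVf _ (lead_coef q)) ?lead_coef_eq0 //.
  by rewrite rmorphM idealMr.
elim: r => [|z r IHr]; first by rewrite big_nil idealr1.
by rewrite big_cons prime_idealrM => /orP[|//]; exists z.
Qed.

Let h := lead_coef F.
Let d := (size F).-1.
Let ws := [seq U ^+ j * g | j <- iota 0 d, g <- gens].
Let N := size ws.
Let w (k : 'I_N) := ws`_k.

(* Modulo M, the powers of U reduce to those below d = deg F after multiplication by a
   power of the leading coefficient h of F, so that ws generates the quotient by M, once
   h is inverted, as a module over K[T] with h inverted. *)
Let spanned r := exists b : 'I_N -> {poly K}, r - \sum_k ev (b k) * w k \in M.
Let hspanned r := exists s, spanned (ev h ^+ s * r).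

Let spanned_congr r r' : r - r' \in M -> spanned r' -> spanned r.
Proof. by move=> rr' [b bM]; exists b; rewrite -[r](subrK r') -addrA rpredD. Qed.

Let spanned0 : spanned 0.
Proof.
exists (fun=> 0); rewrite big1 ?subrr ?rpred0 // => k _.
by rewrite rmorph0 horner0 mul0r.
Qed.

Let spannedD r r' : spanned r -> spanned r' -> spanned (r + r').
Proof.
move=> [b bM] [b' bM']; exists (fun k => b k + b' k).
under eq_bigr do rewrite rmorphD hornerD mulrDl.
by rewrite big_split opprD addrACA rpredD.
Qed.

Let spannedM q r : spanned r -> spanned (ev q * r).
Proof.
move=> [b bM]; exists (fun k => q * b k).
under eq_bigr do rewrite rmorphM hornerM -mulrA.
by rewrite -mulr_sumr -mulrBr idealMr.
Qed.

Let spanned_w k : spanned (w k).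
Proof.
exists (fun j => (j == k)%:R); rewrite (bigD1 k) //= eqxx rmorph1 hornerC mul1r.
rewrite big1 ?addr0 ?subrr ?rpred0 // => j /negPf->.
by rewrite rmorph0 horner0 mul0r.
Qed.

Let evX q s : ev q ^+ s = ev (q ^+ s).
Proof. by rewrite rmorphXn horner_exp. Qed.

Let hspannedD r r' : hspanned r -> hspanned r' -> hspanned (r + r').
Proof.
move=> [s sr] [s' sr']; exists (s + s')%N; rewrite mulrDr.
apply: spannedD; first by rewrite addnC exprD -mulrA [in X in X * _]evX; apply: spannedM.
by rewrite exprD -mulrA [in X in X * _]evX; apply: spannedM.
Qed.

Let hspannedM q r : hspanned r -> hspanned (ev q * r).
Proof. by move=> [s sr]; exists s; rewrite mulrCA; apply: spannedM. Qed.

Let hspanned_congr r r' : r - r' \in M -> hspanned r' -> hspanned r.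
Proof.
move=> rr' [s sr]; exists s; apply: spanned_congr sr.
by rewrite -mulrBr idealMr.
Qed.

Let hspanned0 : hspanned 0.
Proof. by exists 0%N; rewrite mulr0; apply: spanned0. Qed.

Let hspanned_sum (I : finType) (E : I -> R) :
  (forall i, hspanned (E i)) -> hspanned (\sum_i E i).
Proof. by move=> hE; elim/big_ind: _ => //; apply: hspannedD. Qed.

Let hspanned_gens i g : g \in gens -> hspanned (U ^+ i * g).
Proof.
move=> gG; have [n] := ubnP i; elim: n i => // n IHn i; rewrite ltnS => le_in.
have [ltid|ledi] := ltnP i d.
  have wsi : U ^+ i * g \in ws.
    by apply: (allpairs_f (fun j g => U ^+ j * g)); rewrite // mem_iota.
  have ltk : (index (U ^+ i * g)%R ws < N)%N by rewrite index_mem.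
  by exists 0%N; rewrite mul1r -(nth_index 0 wsi); apply: (spanned_w (Ordinal ltk)).
suff [s hs] : hspanned (ev h * (U ^+ i * g)).
  by exists s.+1; rewrite exprSr -mulrA.
have sF : size F = d.+1 by rewrite prednK // lt0n size_poly_eq0.
apply: (@hspanned_congr _ (\sum_(j < d) ev (- F`_j) * (U ^+ (i - d + j) * g))).
  have := idealMr (U ^+ (i - d) * g) F_M; rewrite sF big_ord_recr /= mulrDr.
  have -> : F`_d = h by [].
  congr (_ \in M); rewrite addrC; congr (_ + _).
    by rewrite -{2}(subnK ledi) exprD; ring.
  rewrite mulr_sumr -sumrN; apply: eq_bigr => j _.
  by rewrite rmorphN hornerN exprD; ring.
apply: hspanned_sum => j; apply: hspannedM; apply: IHn.
by apply: leq_trans le_in; have := ltn_ord j; lia.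
Qed.

Let hspanned_all r : hspanned r.
Proof.
move: r; apply: gensP => //.
- by move=> c x /(hspannedM c%:P); rewrite map_polyC hornerC.
- move=> i j g gG; rewrite -mulrA.
  by have := hspannedM 'X^i (hspanned_gens j gG); rewrite map_polyXn hornerXn.
Qed.

(** Otherwise no nonzero polynomial vanishes at T modulo M. Choose c with h c <> 0;
    then T - c has an inverse u modulo M. If B is the
    matrix of multiplication by u on the generators ws, up to powers h ^ s of the
    denominator h, the determinant of h ^ s - (X - c) B vanishes at X = T modulo M,
    by the adjugate formula. But at X = c it is a power of h c, so it is a
    nonzero polynomial. *)
Lemma nullstellensatz : exists c, T - phi c \in M.
Proof.
apply: contrapT => nT.
have ev0 q : ev q \in M -> q = 0.
  by move=> qM; apply: contrapT => /eqP q0; apply: nT; apply: ev_root qM.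
have h0 : h != 0 by rewrite lead_coef_eq0.
have [c hc] := closed_nonrootP h h0.
have TcM : T - phi c \notin M by apply/negP => TcM; apply: nT; exists c.
have [u uM] := maximal_ideal_inv Mmax TcM.
have [s sP] := choice (fun k => hspanned_all (u * w k)).
have [b bM] := choice sP.
pose Q := \matrix_(k, l) ((h ^+ s k) *+ (k == l) - ('X - c%:P) * b k l).
have Qw k : \sum_l ev (Q k l) * w l \in M.
  have := rpredB (idealMr (T - phi c) (bM k)) (idealMr (ev h ^+ s k * w k) uM).
  congr (_ \in M).
  under [RHS]eq_bigr => l _.
    rewrite mxE rmorphB rmorphMn rmorphM rmorphXn rmorphB /= map_polyX map_polyC.
    rewrite !hornerE hornerMn horner_exp mulrBl -mulrA; over.
  rewrite sumrB -mulr_sumr [X in _ = X - _](bigD1 k) //= eqxx mulr1n.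
  rewrite [X in _ = _ + X - _]big1; first by ring.
  by move=> l /negPf; rewrite eq_sym => ->; rewrite mulr0n mul0r.
have detw l : ev (\det Q) * w l \in M.
  have -> : ev (\det Q) * w l = \sum_k ev (\adj Q l k) * \sum_j ev (Q k j) * w j.
    transitivity (\sum_j ev ((\adj Q *m Q) l j) * w j).
      rewrite mul_adj_mx (bigD1 l) //= mxE eqxx big1 ?addr0 // => j jl.
      by rewrite mxE eq_sym (negPf jl) rmorph0 horner0 mul0r.
    under eq_bigr do rewrite mxE rmorph_sum horner_sum mulr_suml.
    rewrite exchange_big; apply: eq_bigr => k _; rewrite mulr_sumr.
    by apply: eq_bigr => j _; rewrite rmorphM hornerM mulrA.
  by apply: rpred_sum => k _; apply: idealMr.
have [t [a aM]] := hspanned_all 1.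
have : ev (\det Q * h ^+ t) \in M.
  rewrite rmorphM hornerM rmorphXn horner_exp.
  have := rpredD (idealMr (ev (\det Q)) aM)
    (rpred_sum (index_enum _) (fun k (_ : true) => idealMr (ev (a k)) (detw k))).
  congr (_ \in M); rewrite mulr1 mulrBr mulr_sumr.
  under [X in _ - X]eq_bigr do rewrite mulrCA.
  by rewrite subrK.
move=> /ev0/eqP; rewrite mulf_eq0 expf_eq0 (negPf h0) andbF orbF => /eqP detQ0.
have : (\det Q).[c] = \prod_k h.[c] ^+ s k.
  rewrite -horner_evalE -det_map_mx.
  have -> : map_mx (horner_eval c) Q = diag_mx (\row_k h.[c] ^+ s k).
    apply/matrixP => k l; rewrite !mxE /horner_eval.
    by rewrite hornerD hornerN hornerM hornerXsubC subrr mul0r subr0 hornerMn horner_exp.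
  by rewrite det_diag; apply: eq_bigr => k _; rewrite mxE.
rewrite detQ0 horner0 => /esym/eqP; rewrite prodf_seq_eq0 => /hasP[k _].
by rewrite /= expf_eq0 => /andP[_]; rewrite -rootE; apply/negP.
Qed.

End Nullstellensatz.

(** The coefficient of the lowest power of f in a relation between f, U and T is, after
    cancelling that power, a multiple of f, so it is a relation between U and T
    modulo M. *)
Lemma maximal_ideal_relation (K : fieldType) (R : idomainType)
    (phi : {rmorphism K -> R}) (M : prime_idealr R) (f T U : R) N
    (c : nat -> nat -> nat -> K) :
    f != 0 -> f \in M ->
    (exists i j k, [/\ (i < N)%N, (j < N)%N, (k < N)%N & c i j k != 0]) ->
    \sum_(i < N) (\sum_(j < N) (\sum_(k < N) phi (c i j k) * T ^+ k) * U ^+ j)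
       * f ^+ i = 0 ->
  exists F : {poly {poly K}}, F != 0 /\
    \sum_(j < size F) (map_poly phi F`_j).[T] * U ^+ j \in M.
Proof.
move=> f0 fM [i [j [k [iN jN kN cijk]]]] sum0.
pose b i := \sum_(j < N) (\sum_(k < N) phi (c i j k) * T ^+ k) * U ^+ j.
pose F i := \poly_(j < N) (\poly_(k < N) c i j k).
have FE i' : \sum_(j < size (F i')) (map_poly phi (F i')`_j).[T] * U ^+ j = b i'.
  rewrite (big_ord_widen N (fun j => (map_poly phi (F i')`_j).[T] * U ^+ j));
    last exact: size_poly.
  rewrite big_mkcond /=; apply: eq_bigr => j' _.
  case: ltnP => [_|le]; last first.
    rewrite [X in X * _]big1 ?mul0r // => k' _.
    have /polyP/(_ k') := nth_default 0 le.
    by rewrite coef_poly ltn_ord coef_poly ltn_ord coef0 => ->; rewrite rmorph0 mul0r.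
  congr (_ * _); rewrite coef_poly ltn_ord.
  rewrite (@horner_coef_wide _ N); last first.
    by apply: leq_trans (size_poly _ _) _; apply: size_poly.
  by apply: eq_bigr => k' _; rewrite coef_map coef_poly ltn_ord.
apply: contrapT => nF.
have bF i' : b i' \in M -> F i' = 0.
  by move=> bM; apply: contrapT => /eqP Fi; apply: nF; exists (F i'); rewrite FE.
have F0b i' : F i' = 0 -> b i' = 0.
  by rewrite -FE => ->; rewrite big1 // => j' _; rewrite coef0 rmorph0 horner0 mul0r.
have Fi : F i = 0.
  apply: (@peel_powers _ (fun z => z = 0) (fun z => z \in M) f (fun i => F i = 0) N b);
    rewrite ?sum0 //.
  - exact: pred_ideal_prop.
  - by move=> z ->; rewrite idealr0.
  - by move=> z /eqP; rewrite mulf_eq0 (negPf f0) => /eqP.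
have : (F i)`_j`_k = 0 by rewrite Fi !coef0.
by rewrite coef_poly jN coef_poly kN => /eqP; apply/negP.
Qed.

Lemma maximal_ideal_point (K : closedFieldType) (R : idomainType)
    (phi : {rmorphism K -> R}) (M : prime_idealr R) (T U : R) (gens : seq R) :
    maximal_ideal M ->
    (forall V : R -> Prop,
      V 0 -> (forall x y, V x -> V y -> V (x + y)) ->
      (forall c x, V x -> V (phi c * x)) ->
      (forall i j g, g \in gens -> V (T ^+ i * U ^+ j * g)) -> forall x, V x) ->
    (forall f g h : R, exists N (c : nat -> nat -> nat -> K),
      (exists i j k, [/\ (i < N)%N, (j < N)%N, (k < N)%N & c i j k != 0]) /\
      \sum_(i < N) (\sum_(j < N) (\sum_(k < N) phi (c i j k) * h ^+ k) * g ^+ j)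
         * f ^+ i = 0) ->
    T != 0 -> (forall u, T * u != 1) ->
  exists c, T - phi c \in M.
Proof.
move=> Mmax gensP dep T0 T1.
have [f [f0 fM]] : exists f, f != 0 /\ f \in M.
  have [TM|/(maximal_ideal_inv Mmax)[u uM]] := boolP (T \in M); first by exists T.
  by exists (T * u - 1); rewrite subr_eq0.
have [N [c [c0 sum0]]] := dep f U T.
have [F [F0 FM]] := maximal_ideal_relation f0 fM c0 sum0.
exact: (nullstellensatz Mmax gensP F0 FM).
Qed.

(** * Two coprime binomials *)

Lemma mcoeff_subM (K : comNzRingType) n (u c : 'X_{1..n}) (a : K) p :
  (p * ('X_[u] - a%:MP))@_(u + c) = p@_c - a * p@_(u + c).
Proof. by rewrite mulrBr mcoeffB mcoeffMX mulrC mcoeffCM. Qed.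

Section DivideByBinomial.
Variables (K : fieldType) (D : nat) (a : K).
Hypothesis D_gt0 : (0 < D)%N.
Local Notation x := ('X_[bidegree D 0] : {mpoly K[2]}).
Local Notation y := ('X_[bidegree 0 D] : {mpoly K[2]}).

Definition reduced (p : {mpoly K[2]}) := forall c, p@_c != 0 -> (c ord0 < D)%N.

Lemma reducedD p q : reduced p -> reduced q -> reduced (p + q).
Proof.
move=> rp rq c; rewrite mcoeffD => pqc.
have [pc|/rp//] := eqVneq p@_c 0; apply: rq.
by apply: contraNneq pqc => ->; rewrite pc addr0.
Qed.

Lemma reducedZ b p : reduced p -> reduced (b *: p).
Proof.
by move=> rp c; rewrite mcoeffZ mulf_eq0 negb_or => /andP[_ /rp].
Qed.

Lemma reduced_division p :
  exists q r, reduced r /\ p = q * (x - a%:MP) + r.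
Proof.
elim/mpolyind: p => [|b c p _ _ [q [r [rr ->]]]].
  by exists 0, 0; split=> [c|]; rewrite ?mcoeff0 ?eqxx // mul0r addr0.
suff [q' [r' [rr' E]]] : exists q r, reduced r /\
    'X_[c] = q * (x - a%:MP) + r.
  exists (b *: q' + q), (b *: r' + r); split.
    by apply: reducedD => //; apply: reducedZ.
  by rewrite E scalerDr mulrDl -scalerAl addrACA.
rewrite -(bidegree_eta c); move: (c ord0) (c ord_max) => i j.
have [n] := ubnP i; elim: n i => // n IHn i; rewrite ltnS => le_in.
have [ltiD|leDi] := ltnP i D.
  exists 0, 'X_[bidegree i j]; split; last by rewrite mul0r add0r.
  by move=> c'; rewrite -mcoeff_msupp msuppX inE => /eqP->; rewrite bidegree0E.
have [|q' [r' [rr' E]]] := IHn (i - D)%N; first by lia.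
exists ('X_[bidegree (i - D) j] + a *: q'), (a *: r'); split; first exact: reducedZ.
have -> : bidegree i j = (bidegree (i - D) j + bidegree D 0)%MM.
  by rewrite bidegreeD subnK // addn0.
rewrite mpolyXD mulrDl mulrBr [_ * a%:MP]mulrC mul_mpolyC.
by rewrite -addrA -scalerAl -scalerDr -E subrK.
Qed.

(** Divide p by x - a, with remainder r of degree less than D in the first
    variable. Then r * (y - b) has degree less than D in that variable as well, but it is
    a multiple of x - a, so it vanishes. *)
Lemma binomial_coprime b p q : p * (y - b%:MP) = q * (x - a%:MP) ->
  exists h, p = h * (x - a%:MP) /\ q = h * (y - b%:MP).
Proof.
have [h [r [rr ->]]] := reduced_division p => E.
pose w := q - h * (y - b%:MP).
have wE : w * (x - a%:MP) = r * (y - b%:MP).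
  rewrite /w mulrBl -E; ring.
have w0 : w = 0.
  apply/eqP/negPn/negP => w0; pose c := mlead w.
  have : (w * (x - a%:MP))@_(bidegree D 0 + c) != 0.
    rewrite mcoeff_subM [w@_(_ + c)]mcoeff_gt_mlead ?mulr0 ?subr0 ?mleadc_eq0 //.
    by apply: lt_mdeg_ltmc; rewrite mdegD mdeg_bidegree addn0 -[X in (X < _)%N]add0n ltn_add2r.
  rewrite wE -mcoeff_msupp => /msuppM_le/allpairsP[[c1 c2] /= [c1r c2y]].
  rewrite mcoeff_msupp in c1r.
  have c20 : c2 ord0 = 0%N.
    have /msuppB_le := c2y; rewrite mem_cat msuppX inE => /orP[/eqP->|].
      by rewrite bidegree0E.
    by rewrite msuppC; case: ifP => // _; rewrite inE => /eqP->; rewrite mnm0E.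
  move=> /(congr1 (fun m : 'X_{1..2} => m ord0)).
  rewrite !mnmDE bidegree0E c20 addn0 => cE.
  by have := rr _ c1r; rewrite -cE; lia.
have r0 : r = 0.
  move/eqP: wE; rewrite w0 mul0r eq_sym mulf_eq0 => /orP[/eqP//|/eqP yb].
  have : (y - b%:MP)@_(bidegree 0 D) = 0 by rewrite yb mcoeff0.
  rewrite mcoeffB mcoeffX eqxx mcoeffC -mdeg_eq0 mdeg_bidegree.
  by rewrite (gtn_eqF D_gt0) mulr0 subr0 => /eqP; rewrite oner_eq0.
by exists h; rewrite r0 addr0; split=> //; apply/eqP; rewrite -subr_eq0 -/w w0.
Qed.

End DivideByBinomial.

(** * Semigroup rings *)

Section SemigroupRingTheory.
Variables (K : fieldType) (n : nat) (G : seq 'X_{1..n}).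
Local Notation R := (semigroup_ring K G).

Definition in_monoid (c : 'X_{1..n}) :=
  exists l, all (mem G) l /\ c = (\sum_(g <- l) g)%MM.

Lemma in_monoid0 : in_monoid 0%MM.
Proof. by exists [::]; rewrite big_nil. Qed.

Lemma in_monoidD c c' : in_monoid c -> in_monoid c' -> in_monoid (c + c')%MM.
Proof.
by move=> [l [lG ->]] [l' [lG' ->]]; exists (l ++ l'); rewrite all_cat lG big_cat.
Qed.

Lemma in_monoid_gen g : g \in G -> in_monoid g.
Proof. by move=> gG; exists [:: g]; rewrite /= gG big_seq1. Qed.

Lemma semigroup_ringP (p : {mpoly K[n]}) :
  p \in @semigroup_ring_pred K n G <-> (forall c, p@_c != 0 -> in_monoid c).
Proof.
split=> [/asboolP pA|pc].
  pose A : {pred {mpoly K[n]}} := fun p => `[< forall c, p@_c != 0 -> in_monoid c >].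
  suff /asboolP: p \in A by [].
  apply: pA; last first.
    move=> g gG; apply/asboolP => c; rewrite -mcoeff_msupp msuppX inE => /eqP->.
    exact: in_monoid_gen.
  split.
  - apply/asboolP => c; rewrite -mcoeff_msupp msupp1 inE => /eqP->.
    exact: in_monoid0.
  - move=> a u v /asboolP uA /asboolP vA; apply/asboolP => c.
    rewrite mcoeffD mcoeffZ; have [->|/uA//] := eqVneq u@_c 0.
    by rewrite mulr0 add0r => /vA.
  - move=> u v /asboolP uA /asboolP vA; apply/asboolP => c.
    rewrite -mcoeff_msupp => /msuppM_le/allpairsP[[c1 c2] /= [c1u c2v ->]].
    by apply: in_monoidD; [apply: uA | apply: vA]; rewrite -mcoeff_msupp.
apply/asboolP => A [A1 AZ AM] GA.
have A0 : 0 \in A by rewrite -[0](addNr 1) -scaleN1r; apply: AZ.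
rewrite [p]mpolyE; elim/big_rec: _ => // c q _ qA.
have [->|/pc cm] := eqVneq p@_c 0; first by rewrite scale0r add0r.
apply: AZ => //; have [l [lG ->]] := cm; rewrite -mpolyX_prod.
elim: l lG => [|g l IHl]; first by rewrite big_nil.
by rewrite big_cons /= => /andP[gG /IHl lA]; apply: AM => //; apply: GA.
Qed.

Lemma semigroup_ring_in_monoid (r : R) c : (val r)@_c != 0 -> in_monoid c.
Proof. exact: ((semigroup_ringP _).1 (valP r) c). Qed.

Lemma semigroup_ring_lift (p : {mpoly K[n]}) :
  (forall c, p@_c != 0 -> in_monoid c) -> exists r : R, val r = p.
Proof. by move/semigroup_ringP => pR; exists (SemigroupRing pR). Qed.

Lemma semigroup_ring_monomial c : in_monoid c -> exists r : R, val r = 'X_[c].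
Proof.
move=> cm; apply: semigroup_ring_lift => c'.
by rewrite -mcoeff_msupp msuppX inE => /eqP->.
Qed.

Lemma val_in_alg (a : K) : val (a%:A : R) = a%:MP.
Proof. by rewrite linearZ /= alg_mpolyC. Qed.

Lemma semigroup_ring_ind (V : R -> Prop) :
  V 0 -> (forall r r', V r -> V r' -> V (r + r')) ->
  (forall a r, V r -> V (a%:A * r)) ->
  (forall c (r : R), in_monoid c -> val r = 'X_[c] -> V r) ->
  forall r, V r.
Proof.
move=> V0 VD VZ VX r.
suff H p : (forall c, p@_c != 0 -> in_monoid c) -> exists2 r' : R, V r' & val r' = p.
  have [|r' Vr' /val_inj <- //] := H (val r).
  by move=> c; apply: semigroup_ring_in_monoid.
elim/mpolyind: p => [|a c p cp a0 IHp] pc; first by exists 0; rewrite ?rmorph0.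
have [|r' Vr' r'E] := IHp.
  move=> c' pc'; apply: pc; rewrite mcoeffD mcoeffZ mcoeffX.
  have [cc'|_] := eqVneq c c'; last by rewrite mulr0 add0r.
  by rewrite -mcoeff_msupp -cc' (negPf cp) in pc'.
have cm : in_monoid c.
  apply: pc; rewrite mcoeffD mcoeffZ mcoeffX eqxx mulr1.
  by rewrite (memN_msupp_eq0 cp) addr0.
have [s sE] := semigroup_ring_monomial cm.
exists (a%:A * s + r'); first by apply: VD => //; apply: VZ; apply: VX sE.
transitivity (val (a%:A : R) * val s + val r'); first by rewrite rmorphD rmorphM.
by rewrite val_in_alg sE r'E mul_mpolyC.
Qed.

End SemigroupRingTheory.

(** * Dickson's lemma and noetherianity *)

Section Dickson.
Variable D : nat.
Hypothesis D_gt0 : (0 < D)%N.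
Local Notation T := 'X_{1..2}.
Variable E : T -> Prop.
Implicit Types (A B : T -> Prop) (s : seq T).

(** Divisibility up to a monomial in t1^D and t2^D. Under this order the exponents form a
    disjoint union of D ^ 2 copies of N ^ 2. *)
Definition below (c c' : T) := exists i j, c' = (c + bidegree (D * i) (D * j))%MM.

Definition finitely_covered A := exists s,
  (forall c, c \in s -> E c) /\
  (forall c, E c -> A c -> exists2 c', c' \in s & below c' c).

Lemma finitely_coveredS A B : (forall c, A c -> B c) ->
  finitely_covered B -> finitely_covered A.
Proof.
by move=> AB [s [sE sB]]; exists s; split=> // c Ec /AB; apply: sB.
Qed.

Lemma finitely_coveredU A B : finitely_covered A -> finitely_covered B ->
  finitely_covered (fun c => A c \/ B c).
Proof.
move=> [s [sE sA]] [t [tE tB]]; exists (s ++ t); split.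
  by move=> c; rewrite mem_cat => /orP[/sE|/tE].
move=> c Ec [/(sA _ Ec)|/(tB _ Ec)] [c' c's cc'];
  by exists c' => //; rewrite mem_cat c's ?orbT.
Qed.

Lemma finitely_covered_bigU k (A : nat -> T -> Prop) :
  (forall i, (i < k)%N -> finitely_covered (A i)) ->
  finitely_covered (fun c => exists2 i, (i < k)%N & A i c).
Proof.
elim: k => [|k IHk] Ak; first by exists [::]; split=> // c _ [].
apply: finitely_coveredS (finitely_coveredU (IHk _) (Ak k _)) => //; last first.
  by move=> i ik; apply: Ak; apply: ltnW.
move=> c [i]; rewrite ltnS leq_eqVlt => /predU1P[->|ik] Ai; [by right | left].
by exists i.
Qed.

Lemma finitely_covered_min A (h : T -> nat) :
  (forall c c', A c -> A c' -> (h c <= h c')%N -> below c c') ->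
  finitely_covered A.
Proof.
move=> Ah; have [[c [Ec Ac]]|nA] := pselect (exists c, E c /\ A c); last first.
  by exists [::]; split=> // c Ec Ac; case: nA; exists c.
have exk : exists k, `[< exists c, [/\ E c, A c & h c = k] >].
  by exists (h c); apply/asboolP; exists c.
case: (ex_minnP exk) => k /asboolP[c0 [Ec0 Ac0 hc0]] kmin.
exists [:: c0]; split=> [c'|c' Ec' Ac']; first by rewrite inE => /eqP->.
exists c0; rewrite ?inE //; apply: Ah => //; rewrite hc0; apply: kmin.
by apply/asboolP; exists c'.
Qed.

Lemma leq_mod_diff a b : (a <= b)%N -> a = b %[mod D] -> exists i, b = (a + D * i)%N.
Proof.
move=> ab /eqP; rewrite eq_sym (eqn_mod_dvd _ ab) => /dvdnP[i E'].
by exists i; rewrite mulnC -E' subnKC.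
Qed.

Lemma below_mod (c c' : T) : c ord0 = c' ord0 %[mod D] ->
  c ord_max = c' ord_max %[mod D] ->
  (c ord0 <= c' ord0)%N -> (c ord_max <= c' ord_max)%N -> below c c'.
Proof.
move=> m0 m1 /leq_mod_diff/(_ m0)[i Ei] /leq_mod_diff/(_ m1)[j Ej].
by exists i, j; rewrite -(bidegree_eta c) bidegreeD -Ei -Ej bidegree_eta.
Qed.

(** Given one point c0 of E in the class, all others lie above c0, or in one of finitely
    many rows or columns, each of which has a least point. *)
Lemma dickson_class p q :
  finitely_covered (fun c => c ord0 %% D = p /\ c ord_max %% D = q)%N.
Proof.
pose C (c : T) := (c ord0 %% D = p /\ c ord_max %% D = q)%N.
have [[c0 [Ec0 Cc0]]|nC] := pselect (exists c, E c /\ C c); last first.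
  by exists [::]; split=> // c Ec Cc; case: nC; exists c.
have row a : finitely_covered (fun c => C c /\ c ord0 = a).
  apply: (@finitely_covered_min _ (fun c => c ord_max)) => c c' [[c_p c_q] ca].
  by move=> [[c'_p c'_q] c'a] le; apply: below_mod; rewrite ?ca ?c'a ?c_q ?c'_q.
have col b : finitely_covered (fun c => C c /\ c ord_max = b).
  apply: (@finitely_covered_min _ (fun c => c ord0)) => c c' [[c_p c_q] cb].
  by move=> [[c'_p c'_q] c'b] le; apply: below_mod; rewrite ?cb ?c'b ?c_p ?c'_p.
have top : finitely_covered (fun c => C c /\ (c0 ord0 <= c ord0)%N /\
    (c0 ord_max <= c ord_max)%N).
  exists [:: c0]; split=> [c|c Ec [[c_p c_q] [le0 le1]]]; first by rewrite inE => /eqP->.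
  exists c0; rewrite ?inE //; apply: below_mod => //.
    by rewrite c_p; case: Cc0.
  by rewrite c_q; case: Cc0.
apply: finitely_coveredS (finitely_coveredU top (finitely_coveredU
  (@finitely_covered_bigU (c0 ord0) _ (fun a _ => row a))
  (@finitely_covered_bigU (c0 ord_max) _ (fun b _ => col b)))) => c Cc.
have [le0|lt0] := leqP (c0 ord0) (c ord0); last by right; left; exists (c ord0).
have [le1|lt1] := leqP (c0 ord_max) (c ord_max); last first.
  by right; right; exists (c ord_max).
by left.
Qed.

Lemma dickson : exists s, (forall c, c \in s -> E c) /\
  (forall c, E c -> exists2 c', c' \in s & below c' c).
Proof.
have [s [sE sA]] := @finitely_covered_bigU D _ (fun p _ =>
  @finitely_covered_bigU D _ (fun q _ => dickson_class p q)).
exists s; split=> // c Ec; apply: sA => //.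
exists (c ord0 %% D)%N; first by rewrite ltn_mod.
by exists (c ord_max %% D)%N; first by rewrite ltn_mod.
Qed.

End Dickson.

Lemma in_ideal_gen_mem (R : comNzRingType) (s : seq R) a : a \in s -> in_ideal_gen s a.
Proof.
move=> sa; rewrite -(nth_index 0 sa); apply: (@in_ideal_gen_take _ (index a s).+1).
by apply: in_ideal_gen_take_nth; rewrite index_mem.
Qed.

Lemma in_ideal_gen_sub (R : comNzRingType) (I : {pred R}) (s : seq R) x :
  idealr_closed I -> {subset s <= I} -> in_ideal_gen s x -> x \in I.
Proof.
move=> [I0 _ IM] sI [c ->]; elim/big_rec: _ => // i z _ zI.
by apply: IM => //; apply: sI; apply: mem_nth.
Qed.

Section SurfaceSemigroup.
Variables (K : fieldType) (G : seq 'X_{1..2}) (D : nat).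
Hypothesis D_gt0 : (0 < D)%N.
Local Notation R := (semigroup_ring K G).
Local Notation dx := (bidegree D 0).
Local Notation dy := (bidegree 0 D).
Variables x y : R.
Hypotheses (xE : val x = 'X_[dx]) (yE : val y = 'X_[dy]).

Lemma val_mul_xy i j (r : R) :
  val (x ^+ i * y ^+ j * r) = 'X_[bidegree (D * i) (D * j)] * val r.
Proof.
transitivity (val x ^+ i * val y ^+ j * val r); first by rewrite !rmorphM !rmorphXn.
rewrite xE yE !mpolyXn -mpolyXD; congr ('X_[_] * _).
by rewrite -[LHS]bidegree_eta !mnmDE !mulmnE !bidegree0E !bidegree1E !mul0n addn0.
Qed.

(** By Dickson's lemma finitely many elements of I have leading monomials that
    divide those of all others by monomials in x and y. Subtracting multiples of
    them lowers the leading monomial. *)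
Lemma semigroup_ring_noetherian : noetherian R.
Proof.
move=> I Iid; have [I0 _ IM] := Iid.
pose E c := exists f : R, [/\ f \in I, val f != 0 & mlead (val f) = c].
have [s [sE sD]] := dickson D_gt0 E.
have exf c : exists f : R, c \in s -> [/\ f \in I, val f != 0 & mlead (val f) = c].
  have [/sE[f fP]|] := boolP (c \in s); last by exists 0.
  by exists f.
have [f fP] := choice exf.
exists (map f s) => r; split; last first.
  by apply: in_ideal_gen_sub => // _ /mapP[c /fP[fI _ _] ->].
have [J0 JD JM] := in_ideal_gen_ideal (map f s).
have [c rc] : {c | mlead (val r) = c} by exists (mlead (val r)).
elim/(well_founded_induction (@ltom_wf 2)): c r rc => c IHc r rc rI.
have [r0|r0] := eqVneq (val r) 0.
  by have -> : r = 0 by apply: val_inj; rewrite r0 rmorph0.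
have [|c0 c0s [i [j cE]]] := sD c; first by exists r.
have [fI f0 flead] := fP c0 c0s.
pose t := x ^+ i * y ^+ j * f c0.
have tE : val t = 'X_[bidegree (D * i) (D * j)] * val (f c0) by apply: val_mul_xy.
have X0 : 'X_[bidegree (D * i) (D * j)] != 0 :> {mpoly K[2]}.
  by rewrite -msupp_eq0 msuppX.
have t0 : val t != 0 by rewrite tE mulf_neq0.
have tlead : mlead (val t) = c by rewrite tE mleadM // mleadXm flead cE addmC.
pose a := mleadc (val r) / mleadc (val t).
have a0 : a != 0 by rewrite mulf_neq0 ?invr_eq0 ?mleadc_eq0.
pose r' := r - a%:A * t.
have r'E : val r' = val r - a *: val t.
  transitivity (val r - val (a%:A : R) * val t); first by rewrite rmorphB rmorphM.
  by rewrite val_in_alg mul_mpolyC.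
have t_gen : in_ideal_gen (map f s) (a%:A * t).
  by rewrite mulrA; apply: (JM); apply: in_ideal_gen_mem; apply: map_f.
have -> : r = r' + a%:A * t by rewrite subrK.
apply: (JD) => //.
have [r'0|r'0] := eqVneq (val r') 0.
  by have -> : r' = 0 by apply: val_inj; rewrite r'0 rmorph0.
apply: (IHc (mlead (val r'))) => //; last first.
  have -> : r' = (- a%:A * x ^+ i * y ^+ j) * f c0 + r by rewrite /r' /t; ring.
  exact: IM.
rewrite lt_neqAle; apply/andP; split.
  apply: contraNneq r'0 => r'c; rewrite -mleadc_eq0 r'c r'E mcoeffB mcoeffZ.
  by rewrite /a tlead rc divfK ?subrr // -{1}tlead mleadc_eq0.
by rewrite r'E (le_trans (mleadB_le _ _)) // mleadZ // rc tlead joinxx.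
Qed.

Lemma semigroup_ring_alg_dep (f g h : R) : exists N (c : nat -> nat -> nat -> K),
    (exists i j k, [/\ (i < N)%N, (j < N)%N, (k < N)%N & c i j k != 0]) /\
    \sum_(i < N) (\sum_(j < N) (\sum_(k < N) in_alg R (c i j k) * h ^+ k) * g ^+ j)
       * f ^+ i = 0.
Proof.
have [N [c [c0 sum0]]] := alg_dep (val f) (val g) (val h).
exists N, c; split=> //; apply: val_inj; rewrite rmorph0 -[RHS]sum0 rmorph_sum.
apply: eq_bigr => i _; rewrite rmorphM rmorphXn rmorph_sum; congr (_ * _).
apply: eq_bigr => j _; rewrite rmorphM rmorphXn rmorph_sum; congr (_ * _).
by apply: eq_bigr => k _; rewrite rmorphM rmorphXn; congr (_ * _).
Qed.

Lemma semigroup_ring_module_gens : exists gens : seq R, forall V : R -> Prop,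
  V 0 -> (forall r r', V r -> V r' -> V (r + r')) ->
  (forall a r, V r -> V (in_alg R a * r)) ->
  (forall i j g, g \in gens -> V (x ^+ i * y ^+ j * g)) -> forall r, V r.
Proof.
have [s [sE sD]] := dickson D_gt0 (in_monoid G).
have exg c : exists g : R, c \in s -> val g = 'X_[c].
  have [/sE/(semigroup_ring_monomial K)[g gE]|] := boolP (c \in s); last by exists 0.
  by exists g.
have [g gE] := choice exg.
exists (map g s) => V V0 VD VZ VX; apply: semigroup_ring_ind => // c r cm rE.
have [c0 c0s [i [j cE]]] := sD c cm.
have -> : r = x ^+ i * y ^+ j * g c0; last by apply: VX; apply: map_f.
by apply: val_inj; rewrite rE [RHS]val_mul_xy gE // -mpolyXD cE addmC.
Qed.

Lemma monomial_not_unit (z u : R) c : c != 0%MM -> val z = 'X_[c] -> z * u != 1.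
Proof.
move=> c0 zE; apply: contraTneq c0 => /(congr1 val).
have -> : val (z * u) = val z * val u by rewrite rmorphM.
rewrite zE rmorph1 => /(congr1 (mcoeff 0%MM)); rewrite mcoeff1 eqxx => E.
have : ('X_[c] * val u)@_0 != 0 by rewrite E oner_eq0.
rewrite -mcoeff_msupp => /msuppM_le/allpairsP[[c1 c2] /= [+ _]].
by rewrite msuppX inE negbK => /eqP-> /esym/eqP; rewrite mnmD_eq0 => /andP[].
Qed.

Lemma dx_neq0 : dx != 0%MM.
Proof. by rewrite -mdeg_eq0 mdeg_bidegree addn0 -lt0n. Qed.

Lemma dy_neq0 : dy != 0%MM.
Proof. by rewrite -mdeg_eq0 mdeg_bidegree -lt0n. Qed.

Lemma val_subC (a : K) (z : R) : val (z - a%:A) = val z - a%:MP.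
Proof. by rewrite -(val_in_alg G) rmorphB. Qed.

Lemma x_sub_neq0 (a : K) : x - a%:A != 0.
Proof.
apply/eqP => /(congr1 val); rewrite val_subC xE rmorph0 => /(congr1 (mcoeff dx)).
rewrite mcoeffB mcoeffX eqxx mcoeffC (negPf dx_neq0) mulr0 subr0 mcoeff0.
by apply/eqP; rewrite oner_eq0.
Qed.

(** The two binomials are coprime in K[t1, t2], so p = h (x - a) and q = h (y - b) for
    some polynomial h, and it remains to see that h lies in R. If c is an exponent of h
    of maximal degree among those outside the semigroup, then c + dx is in the semigroup:
    it occurs either in p, or else in h, with larger degree than c. The same holds
    for c + dy, which contradicts the cancellation property. *)
Lemma binomials_regular (a b : K) (p q : R) :
    (forall c, in_monoid G (dx + c)%MM -> in_monoid G (dy + c)%MM -> in_monoid G c) ->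
    (y - b%:A) * p = q * (x - a%:A) ->
  exists r, p = r * (x - a%:A).
Proof.
move=> cancel /(congr1 val).
have valM (u v : R) : val (u * v) = val u * val v by rewrite rmorphM.
rewrite !valM !val_subC xE yE mulrC => /(binomial_coprime D_gt0)[h [pE qE]].
suff hR c : h@_c != 0 -> in_monoid G c.
  have [r rE] := semigroup_ring_lift hR.
  by exists r; apply: val_inj; rewrite valM val_subC xE rE.
have shift (z : R) u (k : K) : val z = h * ('X_[u] - k%:MP) ->
    (h@_(u + c) != 0 -> in_monoid G (u + c)%MM) -> h@_c != 0 -> in_monoid G (u + c)%MM.
  move=> zE uc hc; have [huc|/uc//] := eqVneq h@_(u + c) 0.
  apply: (@semigroup_ring_in_monoid K _ G z); rewrite zE mcoeff_subM huc.
  by rewrite mulr0 subr0.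
have [k] := ubnP (msize h - mdeg c); elim: k c shift => // k IHk c shift le hc.
have IH u : (0 < mdeg u)%N -> h@_(u + c) != 0 -> in_monoid G (u + c)%MM.
  move=> u0 huc; apply: IHk => //.
    move=> z u' k' zE uc' _; have [huc'|/uc'//] := eqVneq h@_(u' + (u + c)) 0.
    apply: (@semigroup_ring_in_monoid K _ G z); rewrite zE mcoeff_subM huc'.
    by rewrite mulr0 subr0.
  move: huc; rewrite -mcoeff_msupp => /msize_mdeg_lt; rewrite mdegD; lia.
apply: cancel.
  by apply: shift pE _ hc; apply: IH; rewrite mdeg_bidegree addn0.
by apply: shift qE _ hc; apply: IH; rewrite mdeg_bidegree.
Qed.

End SurfaceSemigroup.

(** * The Cohen-Macaulay property *)

Section CohenMacaulay.
Variables (K : closedFieldType) (G : seq 'X_{1..2}) (D : nat).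
Hypothesis D_gt0 : (0 < D)%N.
Local Notation R := (semigroup_ring K G).
Local Notation dx := (bidegree D 0).
Local Notation dy := (bidegree 0 D).
Hypotheses (dxG : in_monoid G dx) (dyG : in_monoid G dy).

(** A maximal ideal contains x - a and y - b for some a and b in K, and these form a
    regular sequence. *)
Lemma semigroup_ring_cohen_macaulay :
  (forall c, in_monoid G (dx + c)%MM -> in_monoid G (dy + c)%MM -> in_monoid G c) ->
  cohen_macaulay R.
Proof.
move=> cancel; have [x xE] := semigroup_ring_monomial K dxG.
have [y yE] := semigroup_ring_monomial K dyG.
split; first exact: semigroup_ring_noetherian D_gt0 _ _ xE yE.
move=> M Mmax.
have dep := @semigroup_ring_alg_dep K G.
have [gens gensP] := semigroup_ring_module_gens D_gt0 xE yE.
have x1 u : x * u != 1 by apply: monomial_not_unit xE; apply: dx_neq0.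
have y1 u : y * u != 1 by apply: monomial_not_unit yE; apply: dy_neq0.
have neq0 z c : val z = 'X_[c] -> z != 0 :> R.
  move=> zE; apply/eqP => z0; move: zE; rewrite z0 rmorph0 => /esym/eqP.
  by rewrite -msupp_eq0 msuppX.
have [a aM] := maximal_ideal_point Mmax gensP dep (neq0 _ _ xE) x1.
have gensP' (V : R -> Prop) : V 0 -> (forall r r', V r -> V r' -> V (r + r')) ->
    (forall a r, V r -> V (in_alg R a * r)) ->
    (forall i j g, g \in gens -> V (y ^+ i * x ^+ j * g)) -> forall r, V r.
  move=> V0 VD VZ VX; apply: gensP => // i j g gG.
  by rewrite [x ^+ i * _]mulrC; apply: VX.
have [b bM] := maximal_ideal_point Mmax gensP' dep (neq0 _ _ yE) y1.
apply: (loc_cohen_macaulay dep (f := x - in_alg R a) (g := y - in_alg R b)) => //.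
  exact: (x_sub_neq0 D_gt0 xE a).
move=> p q E; exact: (@binomials_regular _ _ _ D_gt0 _ _ xE yE a b p q cancel E).
Qed.

End CohenMacaulay.

Section Origin.
Variables (K : fieldType) (G : seq 'X_{1..2}).
Local Notation R := (semigroup_ring K G).

Lemma mcoeff0M n (p q : {mpoly K[n]}) : (p * q)@_0 = p@_0 * q@_0.
Proof. exact: rmorphM. Qed.

Definition origin_pred : {pred R} := fun r => (val r)@_0 == 0.

Lemma origin_ideal : idealr_closed origin_pred.
Proof.
split; first by apply/eqP; rewrite !rmorph0.
  by apply/eqP; rewrite !rmorph1; apply/eqP; rewrite oner_eq0.
move=> a u v /eqP u0 /eqP v0; apply/eqP.
transitivity ((val a * val u)@_0 + (val v)@_0).
  by rewrite -mcoeffD rmorphD rmorphM.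
by rewrite mcoeff0M u0 v0 mulr0 addr0.
Qed.

Lemma origin_prime : prime_idealr_closed origin_pred.
Proof.
move=> u v /eqP; have -> : val (u * v) = val u * val v by rewrite rmorphM.
by rewrite mcoeff0M => /eqP; rewrite mulf_eq0.
Qed.

Lemma origin_maximal : maximal_ideal origin_pred.
Proof.
split=> [|J [J0 J1 JM] MJ r rJ]; first exact: origin_ideal.
apply/negPn/negP => r0; case/negP: J1.
pose a := (val r)@_0.
have a0 : a != 0 by [].
have rM : r - a%:A \in origin_pred.
  apply/eqP; transitivity ((val r)@_0 - (val (a%:A : R))@_0).
    by rewrite -mcoeffB rmorphB.
  by rewrite val_in_alg mcoeffC eqxx mulr1 subrr.
have aJ : a%:A \in J.
  have -> : a%:A = - 1 * (r - a%:A) + r by rewrite mulN1r opprB subrK.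
  by apply: (JM) => //; apply: MJ.
have -> : 1 = a^-1%:A * a%:A + 0 :> R.
  by rewrite addr0 -scalerAl mul1r scalerA mulVf // scale1r.
exact: JM.
Qed.

(** The monomial t^c = r / x lies outside the local ring at the origin, but is multiplied
    into it by the maximal ideal, which is spanned by the monomials other than 1. *)
Lemma semigroup_ring_not_cohen_macaulay D c : (0 < D)%N ->
    bidegree D 0 \in G -> bidegree 0 D \in G ->
    ~ in_monoid G c -> (forall g, g \in G -> in_monoid G (g + c)%MM) ->
  ~ cohen_macaulay R.
Proof.
move=> D_gt0 dxG dyG cG cGD [_ CM].
have [x xE] := semigroup_ring_monomial K (in_monoid_gen dxG).
have [y yE] := semigroup_ring_monomial K (in_monoid_gen dyG).
have [r rE] := semigroup_ring_monomial K (cGD _ dxG).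
have [M ME] := prime_idealr_of origin_ideal origin_prime.
have valM (u v : R) : val (u * v) = val u * val v by rewrite rmorphM.
have Mmax : maximal_ideal M.
  have [_ Omax] := origin_maximal.
  split.
    split; [exact: idealr0 | by rewrite idealr1 |].
    by move=> a u v uM vM; rewrite rpredD // idealMr.
  by move=> J Jid MJ z /(Omax _ Jid) zO; rewrite ME; apply: zO => w; rewrite -ME; apply: MJ.
have x0 : x != 0.
  apply/eqP => x0; move: xE; rewrite x0 rmorph0 => /esym/eqP.
  by rewrite -msupp_eq0 msuppX.
have sM s : s \notin M -> (val s)@_0 != 0 by rewrite ME.
apply: (loc_not_cohen_macaulay (P := M) (f := x) (g := y) (q := x) (r := r)) (CM M Mmax) => //.
- rewrite ME; apply/eqP; rewrite yE mcoeffX -mdeg_eq0 mdeg_bidegree.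
  by rewrite gtn_eqF.
(* The product s * y ^+ k involves the monomial y ^+ k, which x does not divide. *)
- move=> k s a /sM s0 /(congr1 val); rewrite !valM rmorphXn /= xE yE mpolyXn.
  move=> /(congr1 (mcoeff (bidegree 0 D *+ k + 0)%MM)); rewrite mcoeffMX => E.
  move: s0; rewrite E -mcoeff_msupp => /msuppM_le/allpairsP[[c1 c2] /= [_]].
  rewrite msuppX inE => /eqP-> /(congr1 (fun m : 'X_{1..2} => m ord0)).
  by rewrite !mnmDE mulmnE !bidegree0E mnm0E; lia.
- move=> a; rewrite ME => /eqP a0.
  have [|b bE] := @semigroup_ring_lift _ _ G (val a * 'X_[c]).
    move=> c'; rewrite -mcoeff_msupp => /msuppM_le/allpairsP[[c1 c2] /= [c1a]].
    rewrite msuppX inE => /eqP-> ->.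
    have : in_monoid G c1 by apply: (@semigroup_ring_in_monoid K _ _ a); rewrite -mcoeff_msupp.
    case=> -[|g l] [/= lG c1E].
      by move: c1a; rewrite c1E big_nil mcoeff_msupp a0 eqxx.
    case/andP: lG => gG lG; rewrite c1E big_cons -addmA addmC -addmA [(c + g)%MM]addmC.
    by apply: in_monoidD; [exists l | apply: cGD].
  exists b; apply: val_inj; rewrite !valM bE xE rE mpolyXD -!mulrA.
  by congr (_ * _); rewrite mulrC.
- move=> s b /sM s0 /(congr1 val); rewrite !valM xE rE mpolyXD => E.
  have X0 : 'X_[bidegree D 0] != 0 :> {mpoly K[2]} by rewrite -msupp_eq0 msuppX.
  have {}E : val s * 'X_[c] = val b.
    by apply: (mulIf X0); rewrite -E -!mulrA; congr (_ * _); rewrite mulrC.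
  apply: cG; apply: (@semigroup_ring_in_monoid K _ _ b).
  by rewrite -E -[c in _@_c]addm0 mcoeffMX.
Qed.

End Origin.

(** * The semigroup of the projective monomial curve *)

Section Generators.
Variables e m n : nat.
Hypotheses (m_gt0 : (0 < m)%N) (lt_mn : (m < n)%N) (n_le : (n <= e - 2)%N).
Local Notation D := (2 * e - 1)%N.
Local Notation G := (Sbar_gens e m n).

Lemma step_le s : step e m n s -> (s <= D)%N.
Proof. by rewrite /step /gapped; clear -n_le lt_mn; lia. Qed.

Lemma Sbar_gensP g :
  g \in G <-> exists s, step e m n s /\ g = bidegree (D - s) s.
Proof.
rewrite mem_rcons inE; split=> [/predU1P[->|/mapP[i]]|[s [/orP[Ks|/eqP->] ->]]].
- by exists D; rewrite /step eqxx orbT subnn.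
- rewrite mem_filter mem_iota !inE negb_or => /andP[/andP[im i_n] /= ie] ->.
  exists (e - 1 - i)%N; split; last by congr bidegree; lia.
  apply/orP; left; apply/gappedP.
  move/eqP: im; move/eqP: i_n => *.
  by split; [lia | split; lia].
- apply/orP; right; case/gappedP: Ks => se [/eqP sn /eqP sm].
  apply/mapP; exists (e - 1 - s)%N; last by congr bidegree; lia.
  rewrite mem_filter mem_iota !inE negb_or; apply/andP; split; last lia.
  by apply/andP; split; lia.
- by rewrite subnn eqxx.
Qed.

Lemma in_monoid_SbarP a b : in_monoid G (bidegree a b) <-> in_Sbar e m n a b.
Proof.
split.
  move=> [l [lG]]; elim: l lG a b => [|g l IHl] /=.
    move=> _ a b; rewrite big_nil => E; exists [::]; split=> //=.
      by rewrite -(bidegree1E a b) E mnm0E.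
    by rewrite mul0n -mdeg_bidegree E mdeg0.
  case/andP=> /Sbar_gensP[s [Ss ->]] lG a b; rewrite big_cons.
  set c := (\sum_(j <- l) j)%MM => E.
  have [r [Sr sumr sizer]] := IHl lG (c ord0) (c ord_max) (bidegree_eta c).
  have sD := step_le Ss.
  have aE : a = (D - s + c ord0)%N by rewrite -(bidegree0E a b) E mnmDE bidegree0E.
  have bE : b = (s + c ord_max)%N by rewrite -(bidegree1E a b) E mnmDE bidegree1E.
  exists (s :: r); split=> /=; [by rewrite Ss | by rewrite sumr bE |].
  by rewrite mulSn aE bE; clear -sizer sD; lia.
move=> [l [Sl suml sizel]].
suff H : in_monoid G (bidegree (size l * D - sumn l) (sumn l)).
  by move: H; rewrite suml -sizel addnK.
elim: l Sl {suml sizel} => [|s l IHl] /=.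
  by move=> _; rewrite bidegree00; apply: in_monoid0.
case/andP=> Ss Sl; have sD := step_le Ss.
have lD : (sumn l <= size l * D)%N.
  by apply: sumn_le_size; apply/allP => t tl; apply: step_le; apply: (allP Sl).
have -> : bidegree ((size l).+1 * D - (s + sumn l)) (s + sumn l) =
    (bidegree (D - s) s + bidegree (size l * D - sumn l) (sumn l))%MM.
  by rewrite bidegreeD; congr bidegree; rewrite mulSn; clear -sD lD; lia.
apply: in_monoidD; last exact: IHl.
by apply: in_monoid_gen; apply/Sbar_gensP; exists s.
Qed.

End Generators.

Local Close Scope ring_scope.

Theorem corollary4p8 (K : closedFieldType) (charK0 : ([pchar K] =i pred0)%R)
    (e m n : nat) (m_gt0 : 1 <= m) (lt_mn : m < n) (le_ne : n <= e - 2) :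
  cohen_macaulay (semigroup_ring K (Sbar_gens e m n)) <->
  (m, n) <> (e - 4, e - 3).
Proof.
have D_gt0 : (0 < 2 * e - 1)%N by clear -le_ne lt_mn; lia.
have SP := Sbar_gensP m_gt0 lt_mn le_ne.
have MP := in_monoid_SbarP m_gt0 lt_mn le_ne.
have dxG : bidegree (2 * e - 1) 0 \in Sbar_gens e m n.
  apply/SP; exists 0%N; rewrite subn0; split=> //.
  by apply/orP; left; apply/gappedP; clear -le_ne lt_mn; lia.
have dyG : bidegree 0 (2 * e - 1) \in Sbar_gens e m n.
  by apply/SP; exists (2 * e - 1)%N; rewrite subnn /step eqxx orbT.
split=> [CM [mE nE]|good].
  have e5 : (5 <= e)%N by clear -m_gt0 lt_mn mE nE le_ne; lia.
  have [a [b [nab abS]]] := in_Sbar_socle e5.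
  rewrite -mE -nE in nab abS.
  apply: (@semigroup_ring_not_cohen_macaulay K _ _ (bidegree a b) D_gt0 dxG dyG _ _ CM).
    by move/MP.
  move=> g /SP[s [Ss ->]]; rewrite bidegreeD; apply/MP.
  by rewrite addnC [(s + b)%N]addnC; apply: abS.
apply: (@semigroup_ring_cohen_macaulay K _ _ D_gt0 (in_monoid_gen dxG) (in_monoid_gen dyG)).
move=> c; rewrite -(bidegree_eta c) !bidegreeD add0n => /MP cx /MP cy; apply/MP.
by apply: (in_Sbar_cancel m_gt0 lt_mn le_ne good); [rewrite addnC | rewrite addnC].
Qed.
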